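(* Let $K$ be an infinite field, let $n>d>0$ be integers, let $U\subset R_{[n-d-1]}$ be a shifted order ideal of monomials of degree at most $\lfloor\frac{d+1}2\rfloor$, and let $B_d(U)$ be the corresponding squeezed $d$-ball on $[n]$. Let $I(U)\subset R_{[n]}$ be the ideal generated by all monomials $u\in R_{[n-d-1]}$ with $u\notin U$, and let $\alpha(I(U))\subset R_{[n]}$ be the ideal generated by the monomials $\alpha(u)$ with $u\in G(I(U))$. Then: (i) $I_{\Delta^e(B_d(U))}=\alpha(I(U))$. (ii) $\Delta^e(B_d(U))$ is the simplicial complex generated by $$L=\big\{\{i_1,i_2+1,\dots,i_k+k-1\}\cup\{n-d+k,n-d+k+1,\dots,n\} : x_{i_1}x_{i_2}\cdots x_{i_k}\in U,\ i_1\le i_2\le\cdots\le i_k\big\}.$$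
   Context: $K$ is an infinite field, $R_{[n]}=K[x_1,\dots,x_n]$ with each $\deg x_i=1$ ($R_{[0]}=K$), and $[n]=\{1,\dots,n\}$. The Stanley--Reisner ideal $I_\Gamma\subset R_{[n]}$ of a simplicial complex $\Gamma$ on $[n]$ is generated by all squarefree monomials $x_{i_1}\cdots x_{i_k}$ with $\{i_1,\dots,i_k\}\notin\Gamma$. $G(I)$ denotes the set of minimal monomial generators of a monomial ideal $I$. The map $\alpha$ on monomials is $\alpha(x_{i_1}x_{i_2}\cdots x_{i_k})=x_{i_1}x_{i_2+1}\cdots x_{i_k+k-1}$ for $i_1\le i_2\le\cdots\le i_k$. Exterior shifting: let $E=\bigoplus_{k=0}^n\bigwedge^kV$ be the exterior algebra of a $K$-vector space $V$ with basis $e_1,\dots,e_n$; for $S=\{s_1<\cdots<s_k\}\subset[n]$ write $e_S=e_{s_1}\wedge\cdots\wedge e_{s_k}$ (a monomial of $E$). For a graded ideal $J\subset E$, $\mathrm{Gin}(J)$ is the generic initial ideal of $J$ with respect to the degree reverse lexicographic order induced by $e_1>\cdots>e_n$, i.e. the common value of the initial ideals of $\varphi(J)$ for $\varphi$ in a suitable nonempty Zariski open subset of $GL_n(K)$. The exterior face ideal $J_\Gamma\subset E$ of a simplicial complex $\Gamma$ on $[n]$ is generated by all $e_S$ with $S\notin\Gamma$. The exterior algebraic shifted complex $\Delta^e(\Gamma)$ is the simplicial complex on $[n]$ with $J_{\Delta^e(\Gamma)}=\mathrm{Gin}(J_\Gamma)$. For monomials $u=x_{i_1}\cdots x_{i_k}$,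 $v=x_{j_1}\cdots x_{j_k}$ of the same degree with $i_1\le\cdots\le i_k$, $j_1\le\cdots\le j_k$, write $u\preceq v$ if $i_p\le j_p$ for all $p$. A set $U$ of monomials of $R_{[m]}$ is a shifted order ideal of monomials if (i) $\{1,x_1,\dots,x_m\}\subset U$; (ii) $u\in U$ and $v$ divides $u$ imply $v\in U$; (iii) $u\in U$, $v\in R_{[m]}$ a monomial and $u\preceq v$ imply $v\in U$. It is ''of degree at most $k$'' if all its elements have degree at most $k$. Squeezed balls: with $m=n-d-1$ and $U\subset R_{[m]}$ a shifted order ideal of monomials of degree at most $\lfloor\frac{d+1}{2}\rfloor$, for $u=x_{i_1}\cdots x_{i_k}\in U$ with $i_1\le\cdots\le i_k$ put $$F_d(u)=\{i_1,i_1+1\}\cup\{i_2+2,i_2+3\}\cup\cdots\cup\{i_k+2(k-1),i_k+2k-1\}\cup\{n+2k-d,n+2k-d+1,\dots,n\},$$ a $(d+1)$-subset of $[n]$ (with $F_d(1)=\{n-d,\dots,n\}$). $B_d(U)$ is the simplicial complex on $[n]$ generated by $\{F_d(u):u\in U\}$. *)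

(* Defs.v *)
From Stdlib Require Import ClassicalEpsilon.
From HB Require Import structures.
From mathcomp Require Import all_boot all_order all_algebra finmap.
From mathcomp.multinomials Require Import mpoly.

Set Implicit Arguments.
Unset Strict Implicit.
Unset Printing Implicit Defensive.

Import GRing.Theory.

Local Open Scope ring_scope.

(* Ideals are predicates [R -> Prop], compared extensionally.  The ideal is
   two-sided, so that one definition serves the polynomial ring and the
   exterior algebra. *)
Definition ideal_gen (R : nzRingType) (G : R -> Prop) : R -> Prop := fun f =>
  exists s : seq (R * R * R),
    (forall t, t \in s -> G t.1.2) /\ f = \sum_(t <- s) t.1.1 * t.1.2 * t.2.

(** Simplicial complexes: the vertex written [i] in 1..n is the element of
    ['I_n] with value [i - 1]. *)

Definition is_complex n (Gamma : {set {set 'I_n}}) : Prop :=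
  forall S T : {set 'I_n}, T \in Gamma -> S \subset T -> S \in Gamma.

Definition gen_complex n (A : {set {set 'I_n}}) : {set {set 'I_n}} :=
  [set S : {set 'I_n} | [exists F in A, S \subset F]].

Definition SR_ideal (K : fieldType) n (Gamma : {set {set 'I_n}}) :
    {mpoly K[n]} -> Prop :=
  ideal_gen (fun g => exists2 S : {set 'I_n},
    S \notin Gamma & g = \prod_(i in S) 'X_i).

(** Exterior algebra on e_1, ..., e_n: an element is the family of its
    coordinates on the basis (e_S), S a subset of ['I_n]. *)

Definition exterior (K : fieldType) (n : nat) : Type :=
  {ffun {set 'I_n} -> K^o}.

HB.instance Definition _ (K : fieldType) n :=
  GRing.Lmodule.copy (exterior K n) {ffun {set 'I_n} -> K^o}.

Section Exterior.
Variables (K : fieldType) (n : nat).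
Implicit Types (S T U : {set 'I_n}) (f g h : exterior K n).

Definition ecoord f S : K := (f : {ffun {set 'I_n} -> K^o}) S.

Definition ebasis S : exterior K n := [ffun T : {set 'I_n} => (T == S)%:R].

(* e_S e_T = (esign S T) e_(S :|: T): each pair (s, t) that has to be swapped
   contributes -1, and a common index gives 0. *)
Definition esign S T : K :=
  \prod_(s in S) \prod_(t in T)
    (if s == t then 0 else if (s < t)%N then 1 else -1).

Definition wedge f g : exterior K n :=
  \sum_S \sum_T (ecoord f S * ecoord g T * esign S T) *: ebasis (S :|: T).

Lemma ecoordE f : f = \sum_S ecoord f S *: ebasis S.
Proof.
apply/ffunP => T; rewrite sum_ffunE (bigD1 T) //= big1 => [|S neST].
  by rewrite !ffunE eqxx addr0 -[RHS]/(_ * _) mulr1.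
by rewrite !ffunE eq_sym (negPf neST) -[LHS]/(_ * _) mulr0.
Qed.

Lemma ecoord_basis S T : ecoord (ebasis S) T = (T == S)%:R.
Proof. by rewrite /ecoord ffunE. Qed.

Lemma ecoordP a f g S : ecoord (a *: f + g) S = a * ecoord f S + ecoord g S.
Proof. by rewrite /ecoord !ffunE. Qed.

Lemma wedge_linearl g : linear (wedge^~ g).
Proof.
move=> a f1 f2; rewrite /wedge scaler_sumr -big_split /=.
apply: eq_bigr => S _; rewrite scaler_sumr -big_split /=.
by apply: eq_bigr => T _; rewrite scalerA -scalerDl ecoordP !mulrDl !mulrA.
Qed.

Lemma wedge_linearr f : linear (wedge f).
Proof.
move=> a g1 g2; rewrite /wedge scaler_sumr -big_split /=.
apply: eq_bigr => S _; rewrite scaler_sumr -big_split /=.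
apply: eq_bigr => T _; rewrite scalerA -scalerDl ecoordP !mulrDr !mulrDl.
by rewrite !mulrA [a * _]mulrC.
Qed.

HB.instance Definition _ f :=
  GRing.isLinear.Build K (exterior K n) (exterior K n) _ (wedge f)
    (wedge_linearr f).

Definition wedgel g f := wedge f g.

HB.instance Definition _ g :=
  GRing.isLinear.Build K (exterior K n) (exterior K n) _ (wedgel g)
    (wedge_linearl g).

Lemma wedge_suml I (r : seq I) (P : pred I) (F : I -> exterior K n) g :
  wedge (\sum_(i <- r | P i) F i) g = \sum_(i <- r | P i) wedge (F i) g.
Proof. exact: (linear_sum (wedgel g)). Qed.

Lemma wedgeZl a f g : wedge (a *: f) g = a *: wedge f g.
Proof. exact: (linearZ_LR (wedgel g)). Qed.

Lemma wedge_basis S T :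
  wedge (ebasis S) (ebasis T) = esign S T *: ebasis (S :|: T).
Proof.
rewrite /wedge (bigD1 S) //= [X in _ + X]big1 => [|S' neS]; last first.
  by rewrite big1 // => T' _; rewrite ecoord_basis (negPf neS) !mul0r scale0r.
rewrite (bigD1 T) //= [X in _ + X + _]big1 => [|T' neT]; last first.
  by rewrite !ecoord_basis (negPf neT) mulr0 mul0r scale0r.
by rewrite !ecoord_basis !eqxx !mul1r !addr0.
Qed.

Lemma esign_eq0 S T i : i \in S -> i \in T -> esign S T = 0.
Proof.
move=> iS iT; rewrite /esign (bigD1 i) //= (bigD1 i iT) //=.
by rewrite eqxx !mul0r.
Qed.

Lemma esignUl S T U :
  [disjoint S & T] -> esign (S :|: T) U = esign S U * esign T U.
Proof.
move=> dST; rewrite /esign (eq_bigl [predU S & T]) ?bigU // => i.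
by rewrite !inE.
Qed.

Lemma esignUr S T U :
  [disjoint T & U] -> esign S (T :|: U) = esign S T * esign S U.
Proof.
move=> dTU; rewrite /esign -big_split /=; apply: eq_bigr => s _.
by rewrite (eq_bigl [predU T & U]) ?bigU // => i; rewrite !inE.
Qed.

Lemma esign_assoc S T U :
  esign S T * esign (S :|: T) U = esign T U * esign S (T :|: U).
Proof.
have [dST|] := boolP [disjoint S & T]; last first.
  rewrite -setI_eq0 => /set0Pn[i /setIP[iS iT]].
  by rewrite (esign_eq0 iS iT) (@esign_eq0 S _ i) ?mul0r ?mulr0 // inE iT.
have [dTU|] := boolP [disjoint T & U]; last first.
  rewrite -setI_eq0 => /set0Pn[i /setIP[iT iU]].
  by rewrite (esign_eq0 iT iU) (@esign_eq0 _ U i) ?mul0r ?mulr0 // inE iT orbT.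
by rewrite esignUl // esignUr // mulrA mulrC.
Qed.

Lemma wedge_expandl f g : wedge f g = \sum_S ecoord f S *: wedge (ebasis S) g.
Proof.
rewrite {1}(ecoordE f) wedge_suml.
by apply: eq_bigr => S _; rewrite wedgeZl.
Qed.

Lemma wedge_expandr f g : wedge f g = \sum_S ecoord g S *: wedge f (ebasis S).
Proof.
rewrite {1}(ecoordE g) linear_sum.
by apply: eq_bigr => S _; rewrite linearZ.
Qed.

Lemma wedgeA : associative wedge.
Proof.
move=> f g h; rewrite [LHS]wedge_expandl (wedge_expandl f g) wedge_suml.
apply: eq_bigr => S _; rewrite wedgeZl; congr (_ *: _).
rewrite (wedge_expandl g h) (wedge_expandr _ g) wedge_suml linear_sum.
apply: eq_bigr => T _; rewrite wedgeZl linearZ; congr (_ *: _).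
rewrite (wedge_expandr _ h) [RHS]wedge_expandr linear_sum.
apply: eq_bigr => U _; rewrite linearZ; congr (_ *: _).
rewrite !wedge_basis wedgeZl linearZ /= !wedge_basis !scalerA.
by rewrite esign_assoc setUA.
Qed.

Lemma wedge1l : left_id (ebasis set0) wedge.
Proof.
move=> f; rewrite wedge_expandr [RHS]ecoordE; apply: eq_bigr => S _.
by rewrite wedge_basis /esign big_set0 scale1r set0U.
Qed.

Lemma wedge1r : right_id (ebasis set0) wedge.
Proof.
move=> f; rewrite wedge_expandl [RHS]ecoordE; apply: eq_bigr => S _.
rewrite wedge_basis /esign big1 => [|s _]; last by rewrite big_set0.
by rewrite scale1r setU0.
Qed.

Lemma wedgeDl : left_distributive wedge +%R.
Proof. by move=> f g h; exact: (linearD (wedgel h)). Qed.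

Lemma wedgeDr : right_distributive wedge +%R.
Proof. by move=> f g h; exact: linearD. Qed.

Lemma exterior1_neq0 : ebasis set0 != 0.
Proof.
apply/eqP => /(congr1 (ecoord^~ set0)); rewrite ecoord_basis eqxx.
by rewrite /ecoord ffunE => /eqP; rewrite oner_eq0.
Qed.

HB.instance Definition _ := GRing.Zmodule_isNzRing.Build (exterior K n)
  wedgeA wedge1l wedge1r wedgeDl wedgeDr exterior1_neq0.

End Exterior.

(** Generic initial ideals in the exterior algebra *)

(* [mon_lt T S] is e_T < e_S for the degree reverse lexicographic order induced
   by e_1 > ... > e_n: in equal degrees, the largest index on which S and T
   differ belongs to T. *)
Definition mon_lt n (T S : {set 'I_n}) : bool :=
  (#|T| < #|S|)%N ||
  (#|T| == #|S|) &&
  [exists i, [&& i \in T, i \notin S &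
     [forall j : 'I_n, (i < j)%N ==> ((j \in T) == (j \in S))]]].

Definition is_initial (K : fieldType) n (f : exterior K n) (S : {set 'I_n}) :=
  ecoord f S != 0 /\ forall T, ecoord f T != 0 -> T != S -> mon_lt T S.

Definition initial_ideal (K : fieldType) n (J : exterior K n -> Prop) :
    exterior K n -> Prop :=
  ideal_gen (fun g => exists f S,
    [/\ J f, is_initial f S & g = ebasis K S]).

(* The K-algebra endomorphism of E with e_i |-> \sum_j A i j e_j; [enum S] is
   increasing, so the product below is the image of e_S. *)
Definition ext_map (K : fieldType) n (A : 'M[K]_n) (f : exterior K n) :
    exterior K n :=
  \sum_(S : {set 'I_n}) ecoord f S *:
    \prod_(i <- enum S) \sum_j A i j *: ebasis K [set j].

(* Zariski open subsets of GL_n(K), for the topology induced by the affine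
   space of n x n matrices *)
Definition GL_open (K : fieldType) n (O : 'M[K]_n -> Prop) : Prop :=
  exists P : {mpoly K[n * n]} -> Prop, forall A : 'M[K]_n,
    O A <-> (A \in unitmx /\ exists2 p, P p & p.@[mxvec A 0] != 0).

Definition is_Gin (K : fieldType) n (J I : exterior K n -> Prop) : Prop :=
  exists O : 'M[K]_n -> Prop,
    [/\ GL_open O, exists A, O A &
        forall A, O A -> forall g,
          initial_ideal (fun h => exists2 f, J f & h = ext_map A f) g <-> I g].

(* Over an infinite field the [I] such that [is_Gin J I] exists and is unique
   (as a subset of E) for every graded ideal [J]. *)
Definition Gin (K : fieldType) n (J : exterior K n -> Prop) :
    exterior K n -> Prop :=
  epsilon (inhabits J) (is_Gin J).

Definition ext_face_ideal (K : fieldType) n (Gamma : {set {set 'I_n}}) :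
    exterior K n -> Prop :=
  ideal_gen (fun g => exists2 S : {set 'I_n},
    S \notin Gamma & g = ebasis K S).

Definition is_ext_shifting (K : fieldType) n (Gamma Delta : {set {set 'I_n}}) :
    Prop :=
  is_complex Delta /\
  forall f, ext_face_ideal (K := K) Delta f <-> Gin (ext_face_ideal Gamma) f.

Definition ext_shifting (K : fieldType) n (Gamma : {set {set 'I_n}}) :
    {set {set 'I_n}} :=
  epsilon (inhabits set0) (is_ext_shifting K Gamma).

(** Monomials as weakly increasing sequences of indices in 1..n *)

Definition indices n (u : 'X_{1..n}) : seq nat :=
  flatten [seq nseq (u i) i.+1 | i <- enum 'I_n].

(* Only used when all the entries of [s] lie in 1..n; other entries would be
   dropped. *)
Definition monomial_of n (s : seq nat) : 'X_{1..n} :=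
  [multinom count_mem i.+1 s | i < n].

(* i_1, i_2, ..., i_k |-> i_1, i_2 + 1, ..., i_k + k - 1 *)
Definition alpha_seq (s : seq nat) : seq nat :=
  [seq (nth 0 s p + p)%N | p <- iota 0 (size s)].

Definition alpha n (u : 'X_{1..n}) : 'X_{1..n} :=
  monomial_of n (alpha_seq (indices u)).

Definition mon_prec n (u v : 'X_{1..n}) : bool :=
  (mdeg u == mdeg v) && all2 leq (indices u) (indices v).

(* The sets of monomials of interest have bounded degree, hence are finite. *)
Definition shifted_order_ideal m (U : {fset 'X_{1..m}}) : Prop :=
  [/\ (0%MM \in U) /\ (forall i : 'I_m, U_(i)%MM \in U),
      forall u v : 'X_{1..m}, u \in U -> (v <= u)%MM -> v \in U &
      forall u v : 'X_{1..m}, u \in U -> mon_prec u v -> v \in U].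

Definition degree_at_most m (k : nat) (U : {fset 'X_{1..m}}) : Prop :=
  forall u, u \in U -> (mdeg u <= k)%N.

(* G(I) for a monomial ideal I *)
Definition min_gens (K : fieldType) n (I : {mpoly K[n]} -> Prop)
    (u : 'X_{1..n}) : Prop :=
  I 'X_[u] /\ forall v : 'X_{1..n}, (v <= u)%MM -> I 'X_[v] -> v = u.

Definition alpha_ideal (K : fieldType) n (I : {mpoly K[n]} -> Prop) :
    {mpoly K[n]} -> Prop :=
  ideal_gen (fun g => exists2 u, min_gens I u & g = 'X_[alpha u]).

Definition I_of (K : fieldType) n m (U : {fset 'X_{1..m}}) :
    {mpoly K[n]} -> Prop :=
  ideal_gen (fun g => exists2 u : 'X_{1..m},
    u \notin U & g = 'X_[monomial_of n (indices u)]).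

(** Squeezed balls *)

(* In both definitions below [p] runs over 0..k-1, i.e. [p + 1] is the position
   in the index sequence of [u], and [x.+1] is the vertex in 1..n. *)
Definition F_set n d m (u : 'X_{1..m}) : {set 'I_n} :=
  let s := indices u in let k := size s in
  [set x : 'I_n |
    [exists p : 'I_k, (x.+1 == nth 0 s p + 2 * p)%N
                      || (x.+1 == nth 0 s p + 2 * p + 1)%N]
    || (n + 2 * k - d <= x.+1)%N].

Definition L_set n d m (u : 'X_{1..m}) : {set 'I_n} :=
  let s := indices u in let k := size s in
  [set x : 'I_n | (x.+1 \in alpha_seq s) || (n - d + k <= x.+1)%N].

Definition squeezed_ball n d m (U : {fset 'X_{1..m}}) : {set {set 'I_n}} :=
  gen_complex [set F_set n d (fsval u) | u : U].

(* Main.v *)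
From HB Require Import structures.
From Stdlib Require Import ClassicalEpsilon.
Require Import Defs.
From mathcomp Require Import all_boot all_order all_algebra finmap zify.
From mathcomp.multinomials Require Import mpoly.

Set Implicit Arguments.
Unset Strict Implicit.
Unset Printing Implicit Defensive.

Import GRing.Theory.

(** Put m = n - d - 1, let delta be the degree bound of U, and call a sequence
    of positions a-spaced if consecutive terms differ by at least a.  Vertices
    are numbered from 0.

    Combinatorics.  The squeezed ball and the complex generated by L are the
    cases a = 2 and a = 1 of one construction, [facet_complex].  Reading off
    the greedy a-spaced sequence g_0 < g_1 < ... of a set T gives the index
    sequence i_r = g_r - a r + 1 of a monomial, and T is a nonface exactly when
    some monomial u outside U of degree at most delta + 1, with indices s_r,
    dominates it: g_r < s_r + a r for all r ([facet_complexP]).  So the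
    nonfaces are, for both complexes, the same union of intersections of the
    sets [has_spaced a p q] of those T that contain an a-spaced sequence of
    length p in the first q + (a-1)(p-1) positions.  A bijection of the subsets
    of [n], [fold_set], takes [has_spaced 2 p q] to [has_spaced 1 p q] whenever
    q + p - 1 <= n: it moves each letter skipped by the greedy 2-spaced sequence
    to the end of the word.

    Linear algebra.  For a set X of subsets of [n] let J(X) be the span of the
    e_T, T in X.  For an invertible A the initial monomials of A J(X) are as
    many as the elements of X ([card_initials]), increase with X, and form an
    up-set if X is one.  So it suffices to find the initial monomials for
    X = [has_spaced 2 p q]: if they are [has_spaced 1 p q], then for an
    intersection of such sets they are contained in the intersection of the
    [has_spaced 1 p q], for a union of intersections they contain the
    corresponding union, and in both cases the bijection makes the cardinals
    agree, whence equality.  Since [has_spaced 1 p q] is the up-set generated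
    by the p-subsets of the first q vertices, the same count reduces the case
    of one pair (p, q) to showing that all these p-subsets are initial.  For
    that it is enough that a matrix of p-minors of A has full rank: rows the
    2-spaced p-subsets of the first q + p - 1 vertices, columns the p-subsets
    of the first q.  This is an open condition on A, and a Vandermonde matrix
    satisfies it for all (p, q) at once ([vander_functional]): dividing by one
    point of the moment curve gives the moment curve in one dimension less,
    and the 2-spaced sets with and without their last possible element match
    the two terms of Pascal's rule.

    Finally the Stanley-Reisner ideal of the complex generated by L is
    compared with alpha(I(U)) on generators.  The point there is that the
    shortest prefix outside U of an index sequence is a minimal generator of
    I(U) ([min_gens_prefix]), and that alpha is compatible with prefixes. *)

(** * The exterior algebra and its endomorphisms *)

Section ExteriorAlgebra.
Local Open Scope ring_scope.
Variables (K : fieldType) (n : nat).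
Implicit Types (i j k l : 'I_n) (S T : {set 'I_n}) (f g h : exterior K n) (A B : 'M[K]_n).
Local Notation e := (ebasis K).

Lemma ext_scaleAl a f g : (a *: f) * g = a *: (f * g).
Proof. exact: wedgeZl. Qed.

Lemma ext_scaleAr a f g : f * (a *: g) = a *: (f * g).
Proof. exact: (linearZ_LR (wedge f)). Qed.

Lemma ext_mulE f g :
  f * g = \sum_S \sum_T (ecoord f S * ecoord g T) *: (e S * e T).
Proof.
apply: eq_bigr => S _; apply: eq_bigr => T _.
by rewrite -[e S * e T]/(wedge _ _) wedge_basis scalerA.
Qed.

Lemma ecoordD f g S : ecoord (f + g) S = ecoord f S + ecoord g S.
Proof. by rewrite -[f]scale1r ecoordP mul1r scale1r. Qed.

Lemma ecoord0 S : ecoord (0 : exterior K n) S = 0.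
Proof. by rewrite /ecoord ffunE. Qed.

Lemma ecoordZ a f S : ecoord (a *: f) S = a * ecoord f S.
Proof. by rewrite -[a *: f]addr0 ecoordP ecoord0 addr0. Qed.

Lemma ecoord_sum I (r : seq I) (P : pred I) (F : I -> exterior K n) S :
  ecoord (\sum_(i <- r | P i) F i) S = \sum_(i <- r | P i) ecoord (F i) S.
Proof.
exact: (big_morph (fun f => ecoord f S) (fun f g => ecoordD f g S) (ecoord0 S)).
Qed.

Lemma ext_eqP f g : (forall S, ecoord f S = ecoord g S) -> f = g.
Proof. by move=> eq_fg; apply/ffunP => S; apply: eq_fg. Qed.

Lemma ebasis0 : e (set0 : {set 'I_n}) = 1. Proof. by []. Qed.

Lemma ebasis_mul S T : e S * e T = esign K S T *: e (S :|: T).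
Proof. exact: wedge_basis. Qed.

Lemma esign_neq0 S T : [disjoint S & T] -> esign K S T != 0.
Proof.
move=> dST; apply/prodf_neq0 => s sS; apply/prodf_neq0 => t tT.
have [eq_st|_] := eqVneq s t; last by case: ifP; rewrite ?oppr_eq0 oner_eq0.
by move: (disjointFr dST sS); rewrite eq_st tT.
Qed.

Lemma esign11 i j :
  esign K [set i] [set j] = if i == j then 0 else if (i < j)%N then 1 else -1.
Proof. by rewrite /esign !big_set1. Qed.

Lemma ecoord_mulr_vec f j S :
  ecoord (f * e [set j]) S =
    if j \in S then esign K (S :\ j) [set j] * ecoord f (S :\ j) else 0.
Proof.
rewrite ext_mulE ecoord_sum.
have E T : ecoord (\sum_T0 (ecoord f T * ecoord (e [set j]) T0) *: (e T * e T0)) S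
    = ecoord f T * esign K T [set j] * (S == T :|: [set j])%:R.
  rewrite ecoord_sum (bigD1 [set j]) //= [X in _ + X]big1 => [|T0 /negPf neT0].
    by rewrite addr0 ecoordZ ebasis_mul ecoordZ !ecoord_basis eqxx mulr1 mulrA.
  by rewrite ecoordZ ecoord_basis neT0 mulr0 mul0r.
under eq_bigr do rewrite E; case: ifP => jS.
  rewrite (bigD1 (S :\ j)) //= big1 => [|T neT]; last first.
    case: (boolP (S == _)) => [/eqP defS|_]; last by rewrite mulr0.
    case: (boolP (j \in T)) => jT; last first.
      by case/eqP: neT; rewrite defS setUC setU1K.
    by rewrite (@esign_eq0 _ _ _ _ j) ?mulr0 ?mul0r ?inE.
  by rewrite setUC setD1K // eqxx mulr1 addr0 mulrC.
rewrite big1 // => T _; case: (boolP (S == _)) => [/eqP defS|_].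
  by move: jS; rewrite defS !inE eqxx orbT.
by rewrite mulr0.
Qed.

(** * Products of linear forms *)

Definition row_form A i : exterior K n := \sum_j A i j *: e [set j].

Lemma row_formM A f i : f * row_form A i = \sum_j A i j *: (f * e [set j]).
Proof. by rewrite mulr_sumr; apply: eq_bigr => j _; rewrite ext_scaleAr. Qed.

Lemma vec_anticomm i j : e [set i] * e [set j] = - (e [set j] * e [set i]).
Proof.
rewrite !ebasis_mul !esign11 [_ |: _]setUC; case: (ltngtP i j) => [lt|gt|/val_inj->].
- by rewrite -!val_eqE /= (ltn_eqF lt) (gtn_eqF lt) scale1r scaleN1r opprK.
- by rewrite -!val_eqE /= (ltn_eqF gt) (gtn_eqF gt) scale1r scaleN1r.
- by rewrite eqxx scale0r oppr0.
Qed.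

Lemma vec_sq i : e [set i] * e [set i] = 0.
Proof. by rewrite ebasis_mul esign11 eqxx scale0r. Qed.

Lemma row_form_mul A B i j :
  row_form A i * row_form B j
    = \sum_k \sum_l (A i k * B j l) *: (e [set k] * e [set l]).
Proof.
rewrite mulr_suml; apply: eq_bigr => k _; rewrite row_formM.
by apply: eq_bigr => l _; rewrite ext_scaleAl scalerA mulrC.
Qed.

Lemma row_form_anticomm A B i j :
  row_form A i * row_form B j = - (row_form B j * row_form A i).
Proof.
rewrite !row_form_mul exchange_big -sumrN; apply: eq_bigr => k _ /=.
rewrite -sumrN; apply: eq_bigr => l _.
by rewrite vec_anticomm scalerN mulrC.
Qed.

(** In characteristic 2 anticommutativity does not imply that squares vanish;
    here the terms of the double sum cancel in pairs off the diagonal. *)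
Lemma row_form_sq A i : row_form A i * row_form A i = 0.
Proof.
rewrite row_form_mul.
pose F k l := (A i k * A i l) *: (e [set k] * e [set l]).
have anti k l : F k l = - F l k.
  by rewrite /F vec_anticomm scalerN mulrC.
have diag k : F k k = 0 by rewrite /F vec_sq scaler0.
transitivity (\sum_(k < n) (\sum_(l : 'I_n | (l < k)%N) F k l
                      + \sum_(l : 'I_n | (k < l)%N) F k l)).
  apply: eq_bigr => k _; rewrite (bigD1 k) //= -/(F k k) diag add0r.
  rewrite (bigID (fun l : 'I_n => (l < k)%N)) /=; congr (_ + _); apply: eq_bigl => l.
    by rewrite -val_eqE /=; case: ltngtP.
  by rewrite -val_eqE /=; case: ltngtP.
rewrite big_split /= [X in X + _](exchange_big_dep xpredT) //= -big_split big1 //.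
move=> k _; rewrite /= -big_split big1 // => l _ /=; by rewrite anti addNr.
Qed.

Definition form_prod A S : exterior K n := \prod_(i <- enum S) row_form A i.

Lemma enum_ord_sorted S : sorted (fun i j : 'I_n => (i < j)%N) (enum S).
Proof.
rewrite {1}/enum_mem -enumT sorted_filter //; first by move=> ? ? ?; apply: ltn_trans.
have: sorted ltn (map val (enum 'I_n)) by rewrite val_enum_ord iota_ltn_sorted.
by rewrite sorted_map enumT.
Qed.

Lemma sorted_enum_set (s : seq 'I_n) :
  sorted (fun i j : 'I_n => (i < j)%N) s -> enum [set x in s] = s.
Proof.
move=> s_sorted; apply: (@irr_sorted_eq _ (fun i j : 'I_n => (i < j)%N)) => //.
- by move=> ? ? ?; apply: ltn_trans.
- by move=> i; rewrite /= ltnn.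
- exact: enum_ord_sorted.
- by move=> i; rewrite mem_enum inE.
Qed.

Lemma enum_setU1_min i S :
  (forall j, j \in S -> (i < j)%N) -> enum (i |: S) = i :: enum S.
Proof.
move=> i_min; rewrite -[RHS]sorted_enum_set; first by apply: eq_enum => j; rewrite !inE mem_enum.
rewrite /= path_sortedE; last by move=> ? ? ?; apply: ltn_trans.
rewrite enum_ord_sorted andbT; apply/allP => j; rewrite mem_enum; exact: i_min.
Qed.

(** Basis monomials are products over increasing enumerations, so sets are
    built by adding elements below all the others. *)
Lemma set_min_ind (P : {set 'I_n} -> Prop) :
  P set0 ->
  (forall i S, (forall j, j \in S -> (i < j)%N) -> P S -> P (i |: S)) ->
  forall S, P S.
Proof.
move=> P0 PS S; have [k] := ubnP #|S|; elim: k S => // k IH S leSk.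
have [->//|/set0Pn[x0 x0S]] := eqVneq S set0.
case: (@arg_minnP _ x0 (mem S) val x0S) => i iS i_min; change (is_true (i \in S)) in iS.
rewrite -(setD1K iS); apply: PS => [j|].
  rewrite !inE => /andP[ne_ji jS]; rewrite ltn_neqAle eq_sym.
  by rewrite [X in X && _]ne_ji i_min.
by apply: IH; rewrite (cardsD1 i) iS in leSk.
Qed.

Lemma form_prod0 A : form_prod A set0 = 1.
Proof. by rewrite /form_prod enum_set0 big_nil. Qed.

Lemma form_prodU1 A i S : (forall j, j \in S -> (i < j)%N) ->
  form_prod A (i |: S) = row_form A i * form_prod A S.
Proof. by move=> i_min; rewrite /form_prod enum_setU1_min // big_cons. Qed.

Lemma esignU1 i j T : (forall k, k \in T -> (j < k)%N) ->
  esign K [set i] (j |: T) = esign K [set i] [set j] * esign K [set i] T.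
Proof.
move=> j_min; apply: esignUr; rewrite disjoints1.
by apply/negP => /j_min; rewrite ltnn.
Qed.

Lemma esign_min i S : (forall j, j \in S -> (i < j)%N) -> esign K [set i] S = 1.
Proof.
move=> i_min; rewrite /esign big_set1 big1 // => j /i_min lt_ij.
by rewrite -val_eqE /= ltn_eqF // lt_ij.
Qed.

Lemma row_form_prod A i T :
  row_form A i * form_prod A T = esign K [set i] T *: form_prod A (i |: T).
Proof.
elim/set_min_ind: T => [|j T j_min IH].
  by rewrite -form_prodU1 ?esign_min ?scale1r // => k; rewrite inE.
case: (ltngtP i j) => [lt_ij|gt_ij|/val_inj eq_ij].
- have i_min k : k \in j |: T -> (i < k)%N.
    by case/setU1P=> [->//|/j_min]; apply: ltn_trans.
  by rewrite esign_min // scale1r [RHS]form_prodU1.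
- rewrite form_prodU1 // mulrA row_form_anticomm mulNr -mulrA IH ext_scaleAr.
  rewrite esignU1 // esign11 -val_eqE /= gtn_eqF // ltnNge ltnW //= mulN1r.
  rewrite -form_prodU1 ?scaleNr; first by rewrite setUCA.
  by move=> k /setU1P[->|/j_min].
- rewrite -eq_ij (@esign_eq0 _ _ _ _ i) ?scale0r; try by rewrite !inE eqxx.
  by rewrite form_prodU1 ?eq_ij // mulrA row_form_sq mul0r.
Qed.

(** The forms given by the rows of A multiply like the generators e_i, since
    they anticommute and square to 0; this makes [ext_map A] multiplicative. *)
Lemma form_prodM A S T :
  form_prod A S * form_prod A T = esign K S T *: form_prod A (S :|: T).
Proof.
elim/set_min_ind: S => [|i S i_min IH].
  by rewrite form_prod0 mul1r set0U /esign big_set0 scale1r.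
rewrite form_prodU1 // -mulrA IH ext_scaleAr row_form_prod scalerA.
by rewrite -esign_assoc esign_min // mul1r setUA.
Qed.

(** * The algebra endomorphism attached to a matrix *)

Lemma ext_mapE A f : ext_map A f = \sum_S ecoord f S *: form_prod A S.
Proof. by []. Qed.

Lemma ext_map_linear A : linear (ext_map A).
Proof.
move=> a f g; rewrite !ext_mapE scaler_sumr -big_split; apply: eq_bigr => S _.
by rewrite ecoordP scalerDl scalerA.
Qed.

HB.instance Definition _ A :=
  GRing.isLinear.Build K (exterior K n) (exterior K n) _ (ext_map A)
    (ext_map_linear A).

Lemma ext_linear_eq (F G : {linear exterior K n -> exterior K n}) :
  (forall S, F (e S) = G (e S)) -> F =1 G.
Proof.
move=> eqFG f; rewrite (ecoordE f) (linear_sum F) (linear_sum G).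
by apply: eq_bigr => S _; rewrite (linearZ_LR F) (linearZ_LR G) eqFG.
Qed.

Lemma ext_map_basis A S : ext_map A (e S) = form_prod A S.
Proof.
rewrite ext_mapE (bigD1 S) //= big1 => [|T /negPf neTS].
  by rewrite ecoord_basis eqxx scale1r addr0.
by rewrite ecoord_basis neTS scale0r.
Qed.

Lemma ext_mapM A f g : ext_map A (f * g) = ext_map A f * ext_map A g.
Proof.
rewrite ext_mulE linear_sum mulr_suml; apply: eq_bigr => S _.
rewrite linear_sum mulr_sumr; apply: eq_bigr => T _.
rewrite linearZ ebasis_mul linearZ ext_scaleAl ext_scaleAr scalerA /=.
by rewrite ext_map_basis -/(form_prod A S) -/(form_prod A T) form_prodM !scalerA.
Qed.

Lemma ext_map1 A : ext_map A 1 = 1.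
Proof. by rewrite -ebasis0 ext_map_basis form_prod0. Qed.

Lemma ebasisU1 i S : (forall j, j \in S -> (i < j)%N) -> e (i |: S) = e [set i] * e S.
Proof. by move=> i_min; rewrite ebasis_mul esign_min // scale1r. Qed.

Lemma ext_map_vec A i : ext_map A (e [set i]) = row_form A i.
Proof. by rewrite ext_map_basis /form_prod enum_set1 big_seq1. Qed.

Lemma ext_map_comp A B f : ext_map B (ext_map A f) = ext_map (A *m B) f.
Proof.
apply: (@ext_linear_eq (ext_map B \o ext_map A) (ext_map (A *m B))) => S /=.
elim/set_min_ind: S => [|i S i_min IH]; first by rewrite !ext_map1.
rewrite ebasisU1 // !ext_mapM IH; congr (_ * _).
rewrite !ext_map_vec linear_sum /row_form.
transitivity (\sum_j \sum_k (A i j * B j k) *: e [set k]).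
  apply: eq_bigr => j _; rewrite linearZ /= ext_map_vec scaler_sumr.
  by apply: eq_bigr => k _; rewrite scalerA.
by rewrite exchange_big; apply: eq_bigr => k _; rewrite mxE scaler_suml.
Qed.

Lemma ext_map_id f : ext_map 1%:M f = f.
Proof.
rewrite [in RHS](ecoordE f) ext_mapE; apply: eq_bigr => S _; congr (_ *: _).
elim/set_min_ind: S => [|i S i_min IH]; first exact: form_prod0.
rewrite form_prodU1 // IH ebasisU1 //; congr (_ * _).
rewrite /row_form (bigD1 i) //= big1 => [|j /negPf neij].
  by rewrite mxE eqxx scale1r addr0.
by rewrite mxE eq_sym neij scale0r.
Qed.

Lemma ext_mapK A : A \in unitmx -> cancel (ext_map A) (ext_map (invmx A)).
Proof. by move=> uA f; rewrite ext_map_comp mulmxV // ext_map_id. Qed.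

Lemma ext_mapVK A : A \in unitmx -> cancel (ext_map (invmx A)) (ext_map A).
Proof. by move=> uA f; rewrite ext_map_comp mulVmx // ext_map_id. Qed.

Lemma form_prod_homog A S T : ecoord (form_prod A S) T != 0 -> #|T| = #|S|.
Proof.
rewrite /form_prod cardE [#|S|]cardE; move: (enum S) => s {S}.
elim/last_ind: s T => [|s i IH] T.
  rewrite big_nil -ebasis0 ecoord_basis.
  by have [->|_] := eqVneq T set0; rewrite ?eqxx // enum_set0.
rewrite -cats1 big_cat /= big_seq1 row_formM ecoord_sum => nz.
have [j nzj] : exists j, ecoord (A i j *: ((\prod_(k <- s) row_form A k) * e [set j])) T != 0.
  apply/existsP; apply: contraNT nz => /existsPn z; apply/eqP; apply: big1 => j _.
  by apply/eqP; move: (z j); rewrite negbK.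
move: nzj; rewrite ecoordZ mulf_eq0 negb_or => /andP[_]; rewrite ecoord_mulr_vec.
case: ifP => [jT|]; last by rewrite eqxx.
rewrite mulf_eq0 negb_or => /andP[_ /IH]; rewrite -!cardE => cardT.
by rewrite (cardsD1 j) jT cardT size_cat addnC.
Qed.

End ExteriorAlgebra.

(** * Points of the moment curve in the exterior algebra *)

Section Vandermonde.
Local Open Scope ring_scope.
Variables (K : fieldType) (n : nat) (x : 'I_n -> K).
Hypothesis x_inj : injective x.
Local Notation e := (ebasis K).
Local Notation E := (exterior K n).

Definition spaced (a : nat) (t : seq 'I_n) := sorted (fun i j : 'I_n => (i + a <= j)%N) t.

Definition vander : 'M[K]_n := \matrix_(i, j) x i ^+ j.

Local Notation l := (row_form vander).

(** The values phi(u e_c) are the coefficients of a polynomial of degree less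
    than [size Y] that vanishes at the [size Y] nodes of [Y]. *)
Lemma vander_functional_base (phi : {linear E -> K^o}) (Y : seq 'I_n) u :
  uniq Y -> (forall y, y \in Y -> phi (u * l y) = 0) ->
  (forall c : 'I_n, (size Y <= c)%N -> phi (u * e [set c]) = 0) ->
  forall c, phi (u * e [set c]) = 0.
Proof.
move=> uY lY hiY c.
pose P : {poly K} := \poly_(j < n) oapp (fun c => phi (u * e [set c])) 0 (insub j).
have coefP (j : 'I_n) : P`_j = phi (u * e [set j]) by rewrite coef_poly ltn_ord valK.
rewrite -coefP; suff -> : P = 0 by rewrite coef0.
apply/eqP; apply: contraT => nzP.
suff : (size (map x Y) < size P)%N.
  rewrite size_map ltnNge => /negP[]; apply/leq_sizeP => j le_j.
  have [lt_jn|le_nj] := ltnP j n; last by rewrite coef_poly ltnNge le_nj.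
  by rewrite (coefP (Ordinal lt_jn)) hiY.
apply: max_poly_roots nzP _ _; last by rewrite map_inj_uniq.
apply/allP=> _ /mapP[y yY ->]; apply/eqP; rewrite horner_poly -[RHS](lY y yY).
rewrite row_formM linear_sum; apply: eq_bigr => j _.
by rewrite linearZ valK mxE mulrC.
Qed.

(** Dual form of the statement that the 2-spaced p-fold products of the first
    q + p - 1 points of the moment curve span the p-th exterior power of a
    q-dimensional space.  The space is the quotient of K^n by the points of [Y]
    and by the e_c with c >= q + size Y, so that [Y] records the points already
    divided out.  The induction divides by the last point y0 of the window, at
    position q + p - 2.  The functional u |-> phi(u l_y0) falls under the case
    of p - 1 and q - 1, whose window is shorter by two and hence leaves the gap
    before y0; once it is zero, phi itself factors through the quotient and
    falls under the case of p and q - 1. *)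
Lemma vander_functional q p (phi : {linear E -> K^o}) (Y : seq 'I_n) :
  ((q + p).-1 <= n)%N -> uniq Y -> (forall y, y \in Y -> ((q + p).-1 <= y)%N) ->
  (forall S : {set 'I_n}, #|S| != p -> phi (e S) = 0) ->
  (forall t, size t = p -> spaced 2 t -> all (fun i : 'I_n => (i < (q + p).-1)%N) t ->
     phi (\prod_(i <- t) l i) = 0) ->
  (forall y u, y \in Y -> phi (u * l y) = 0) ->
  (forall (c : 'I_n) u, (q + size Y <= c)%N -> phi (u * e [set c]) = 0) ->
  forall S, phi (e S) = 0.
Proof.
elim: q p phi Y => [|q IH] [|p] phi Y le_n uY geY deg0 H1 H2 H3 S.
- have [|] := eqVneq #|S| 0%N; last exact: deg0.
  by move=> /cards0_eq->; rewrite ebasis0 -(H1 [::]) // big_nil.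
- have [cardS|] := eqVneq #|S| p.+1; last exact: deg0.
  have /card_gt0P[c cS] : (0 < #|S|)%N by rewrite cardS.
  have dS : [disjoint S :\ c & [set c]] by rewrite disjoint_sym disjoints1 !inE eqxx.
  have /(congr1 phi) := ebasis_mul K (S :\ c) [set c].
  rewrite setUC setD1K // linearZ (@vander_functional_base _ Y) => [|//|y|d].
  - move/esym/eqP; rewrite mulf_eq0 (negPf (esign_neq0 K dS)) => /eqP //.
  - exact: H2.
  - exact: H3.
- have [|] := eqVneq #|S| 0%N; last exact: deg0.
  by move=> /cards0_eq->; rewrite ebasis0 -(H1 [::]) // big_nil.
have lt_y0 : (q + p < n)%N by lia.
pose y0 := Ordinal lt_y0.
have uY0 : uniq (y0 :: Y).
  by rewrite /= uY andbT; apply/negP => /geY /=; lia.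
have geY0 y : y \in y0 :: Y -> (q + p <= y)%N.
  by rewrite inE => /predU1P[->//|/geY]; lia.
pose psi : {linear E -> K^o} := phi \o wedgel (l y0).
have psiE u : psi u = phi (u * l y0) by [].
have psi0 u : psi u = 0.
  rewrite (ecoordE u) linear_sum big1 // => T _; rewrite linearZ /=.
  suff -> : phi (wedgel (l y0) (e T)) = 0 by rewrite scaler0.
  apply: (IH p psi (y0 :: Y)) => //= [|y /geY0|R|t size_t spt allt|y v|c v] /=; try lia.
  - move=> neR; change (phi (e R * l y0) = 0); rewrite row_formM linear_sum big1 // => j _.
    rewrite linearZ ebasis_mul linearZ /= -/(e _).
    have [jR|jR] := boolP (j \in R).
      by rewrite (@esign_eq0 _ _ _ _ j) ?scale0r ?scaler0 // inE.
    rewrite deg0 ?scaler0 //; apply: contra neR.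
    by rewrite setUC cardsU1 jR.
  - change (phi (\prod_(i <- t) l i * l y0) = 0).
    have -> : \prod_(i <- t) l i * l y0 = \prod_(i <- rcons t y0) l i.
      by rewrite -cats1 big_cat /= big_seq1.
    apply: H1.
    + by rewrite size_rcons size_t.
    + case: t allt spt {size_t} => //= i t allt spt; rewrite rcons_path spt /=.
      have: last i t \in i :: t by apply: mem_last.
      by move/(allP (s := i :: t) allt) => /=; lia.
    + rewrite all_rcons /=; apply/andP; split; first lia.
      by apply: sub_all allt => i /=; lia.
  - change (y \in y0 :: Y -> phi (v * l y * l y0) = 0); rewrite inE -mulrA; case/predU1P => [->|yY].
      by rewrite row_form_sq mulr0 linear0.
    by rewrite row_form_anticomm mulrN mulrA linearN (H2 y) // oppr0.
  - move=> lec; change (phi (v * e [set c] * l y0) = 0); rewrite -mulrA.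
    have -> : e [set c] = row_form 1%:M c by rewrite -ext_map_vec ext_map_id.
    rewrite row_form_anticomm mulrN mulrA linearN -(ext_map_vec 1%:M) ext_map_id.
    by rewrite H3 ?oppr0 //; lia.
apply: (IH p.+1 phi (y0 :: Y)) => //= [|y /geY0|t st spt allt|y u|c u lec]; try lia.
- by apply: H1 => //; apply: sub_all allt => i /=; lia.
- by rewrite inE => /predU1P[->|/H2//]; apply: psi0.
- by apply: H3; lia.
Qed.

End Vandermonde.

(** * Initial monomials of subspaces *)

Section MonomialOrder.
Variable n : nat.
Implicit Types R S T : {set 'I_n}.

Definition asbool (P : Prop) : bool :=
  if excluded_middle_informative P then true else false.

Lemma asboolP P : reflect P (asbool P).
Proof. by rewrite /asbool; case: excluded_middle_informative => h; constructor. Qed.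

Lemma mon_ltP T S : reflect
  ((#|T| < #|S|) \/ (#|T| = #|S| /\ exists i, [/\ i \in T, i \notin S &
     forall j : 'I_n, i < j -> (j \in T) = (j \in S)]))
  (mon_lt T S).
Proof.
apply: (iffP orP) => [[->|]|[->|[-> [i [iT iS above]]]]]; try by [left].
  case/andP=> /eqP-> /existsP[i /and3P[iT iS /forallP above]]; right; split=> //.
  by exists i; split=> // j lt_ij; apply/eqP; move: (above j); rewrite lt_ij.
right; rewrite eqxx; apply/existsP; exists i; rewrite iT iS; apply/forallP => j.
by apply/implyP => /above->.
Qed.

Lemma mon_lt_irr S : mon_lt S S = false.
Proof.
apply/negP => /mon_ltP[|[_ [i [iS]]]]; first by rewrite ltnn.
by rewrite iS.
Qed.

Lemma mon_lt_trans : transitive (@mon_lt n).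
Proof.
move=> S T R /mon_ltP lt_TS /mon_ltP lt_SR; apply/mon_ltP.
case: lt_TS => [lt_TS|[eq_TS [i [iT iS abi]]]].
  left; case: lt_SR => [|[<-]//]; exact: ltn_trans.
case: lt_SR => [|[eq_SR [j [jS jR abj]]]]; first by rewrite -eq_TS; left.
right; rewrite eq_TS; split=> //; case: (ltngtP i j) => [lt_ij|gt_ij|/val_inj eq_ij].
- exists j; split=> // [|k lt_jk]; first by rewrite abi.
  by rewrite abi ?abj // (ltn_trans lt_ij).
- exists i; split=> // [|k lt_ik]; first by rewrite -abj.
  by rewrite abi ?abj // (ltn_trans gt_ij).
- by rewrite eq_ij jS in iS.
Qed.

Lemma mon_lt_total S T : S != T -> mon_lt S T || mon_lt T S.
Proof.
move=> neST; case: (ltngtP #|S| #|T|) => [lt|gt|eq_c].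
- by apply/orP; left; apply/mon_ltP; left.
- by apply/orP; right; apply/mon_ltP; left.
pose D := [pred i | (i \in S) != (i \in T)].
have [i0 Di0] : exists i, i \in D.
  apply/existsP; apply: contraNT neST => /existsPn noD; apply/eqP/setP => i.
  by apply/eqP; move: (noD i); rewrite !inE negbK.
case: (@arg_maxnP _ i0 D val Di0) => i Di max_i.
have above (j : 'I_n) : i < j -> (j \in S) = (j \in T).
  move=> lt_ij; apply/eqP; apply: contraLR lt_ij => Dj; rewrite -leqNgt.
  exact: max_i.
move: Di; rewrite /D /=; case: (boolP (i \in S)) => iS; case: (boolP (i \in T)) => iT // _.
- by apply/orP; left; apply/mon_ltP; right; split=> //; exists i.
- apply/orP; right; apply/mon_ltP; right; split=> //; exists i.
  by split=> // j /above->.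
Qed.

(** The element with the fewest elements of X above it. *)
Lemma mon_max (X : {set {set 'I_n}}) : X != set0 ->
  exists2 S, S \in X & forall T, T \in X -> T != S -> mon_lt T S.
Proof.
case/set0Pn=> S0 S0X.
pose above S := [set R in X | mon_lt S R].
case: (@arg_minnP _ S0 (mem X) (fun S => #|above S|) S0X) => S.
rewrite /= => SX min_S; exists S => // T TX neTS.
case/orP: (mon_lt_total neTS) => // lt_ST.
have: #|above T| < #|above S|.
  apply: proper_card; apply/properP; split.
    by apply/subsetP => R; rewrite !inE => /andP[-> /(mon_lt_trans lt_ST)].
  by exists T; rewrite !inE ?TX ?lt_ST ?mon_lt_irr.
by rewrite ltnNge min_S.
Qed.

End MonomialOrder.

Section Initials.
Local Open Scope ring_scope.
Variables (K : fieldType) (n : nat).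
Local Notation E := (exterior K n).
Local Notation e := (ebasis K).
Implicit Types (X Y : {set {set 'I_n}}) (S T R : {set 'I_n}) (f g h : E) (A : 'M[K]_n).

Definition initials (J : E -> Prop) : {set {set 'I_n}} :=
  [set S | asbool (exists2 f, J f & is_initial f S)].

Lemma initialsP (J : E -> Prop) S :
  reflect (exists2 f, J f & is_initial f S) (S \in initials J).
Proof. by rewrite inE; apply: asboolP. Qed.

Lemma has_initial f : f != 0 -> exists S, is_initial f S.
Proof.
move=> nzf; have [|S] := @mon_max n [set S | ecoord f S != 0].
  apply: contraNneq nzf => supp0; apply/eqP/ext_eqP => S; rewrite ecoord0.
  by apply/eqP/negPn; move/setP/(_ S): supp0; rewrite !inE => ->.
rewrite inE => nzS maxS; exists S; split=> // T nzT neTS.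
by apply: maxS; rewrite ?inE.
Qed.

Definition supported X f := forall S, ecoord f S != 0 -> S \in X.

Definition image_span A X h := exists2 f, supported X f & h = ext_map A f.

Lemma supportedE X f : supported X f -> f = \sum_(S in X) ecoord f S *: e S.
Proof.
move=> fX; rewrite {1}(ecoordE f) [RHS]big_mkcond; apply: eq_bigr => S _.
case: ifP => // /negP SX; have [->|/fX//] := eqVneq (ecoord f S) 0.
by rewrite scale0r.
Qed.

(** A matrix with more rows than columns has a nontrivial left kernel. *)
Lemma kernel_comb (I J : finType) (X : {set I}) (Y : {set J}) (F : I -> J -> K) :
  (#|Y| < #|X|)%N ->
  exists c : I -> K, (exists2 i, i \in X & c i != 0) /\
    forall j, j \in Y -> \sum_(i in X) c i * F i j = 0.
Proof.
move=> ltYX; pose M := \matrix_(a < #|X|, b < #|Y|) F (enum_val a) (enum_val b).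
have : kermx M != 0.
  rewrite -mxrank_eq0 mxrank_ker subn_eq0 -ltnNge.
  by apply: leq_ltn_trans (rank_leq_col _) ltYX.
case/rowV0Pn => v /sub_kermxP vM nzv.
have [a nza] : exists a, v 0 a != 0.
  apply/existsP; apply: contraNT nzv => /existsPn v0; apply/eqP/rowP => a.
  by rewrite mxE; apply/eqP/negPn/v0.
pose c i := if [pick a | enum_val a == i] is Some a then v 0 a else 0.
have cE a' : c (enum_val a') = v 0 a'.
  rewrite /c; case: pickP => [b /eqP/enum_val_inj->//|/(_ a')].
  by rewrite eqxx.
exists c; split; first by exists (enum_val a); rewrite ?enum_valP ?cE.
move=> j jY; move/rowP/(_ (enum_rank_in jY j)): vM; rewrite !mxE => vMj.
rewrite -[RHS]vMj big_enum_val; apply: eq_bigr => a' _.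
by rewrite cE mxE enum_rankK_in.
Qed.

(** Elements of A J(X) with distinct initial monomials are independent, which
    bounds their number by dim J(X) = #|X|.  Conversely an element of A J(X)
    none of whose coordinates is on an initial monomial is 0, so A J(X) embeds
    in the coordinate space of its initial monomials. *)
Lemma card_initials A X : A \in unitmx -> #|initials (image_span A X)| = #|X|.
Proof.
move=> uA; apply/eqP; rewrite eqn_leq; apply/andP; split; rewrite leqNgt; apply/negP.
  move=> lt_card.
  (* w S is a preimage of an element with initial monomial S *)
  have wit S : exists f, S \in initials (image_span A X) ->
      supported X f /\ is_initial (ext_map A f) S.
    have [/initialsP[_ [f fX ->] fS]|] := boolP (S \in initials _); last by exists 0.
    by exists f.
  pose w S := proj1_sig (constructive_indefinite_description _ (wit S)).
  have wP S : S \in initials (image_span A X) ->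
      supported X (w S) /\ is_initial (ext_map A (w S)) S.
    by rewrite /w; case: constructive_indefinite_description.
  have [c [[S1 S1I nzc] c0]] := kernel_comb (fun S T => ecoord (w S) T) lt_card.
  have comb0 : \sum_(S in initials (image_span A X)) c S *: w S = 0.
    apply: ext_eqP => T; rewrite ecoord_sum ecoord0.
    have [TX|TnX] := boolP (T \in X).
      by rewrite -[RHS](c0 T TX); apply: eq_bigr => S _; rewrite ecoordZ.
    apply: big1 => S /wP[wX _]; rewrite ecoordZ.
    by have [->|/wX] := eqVneq (ecoord (w S) T) 0; rewrite ?mulr0 // (negPf TnX).
  have [|S] := @mon_max n [set S in initials (image_span A X) | c S != 0].
    by apply/set0Pn; exists S1; rewrite inE S1I.
  rewrite inE => /andP[SI nzS] maxS.
  move/(congr1 (fun f => ecoord (ext_map A f) S)): comb0.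
  rewrite linear_sum linear0 ecoord0 ecoord_sum (bigD1 S) //= big1 => [|T /andP[TI neTS]].
    rewrite addr0 linearZ ecoordZ; case: (wP S SI) => _ [nz _].
    by move/eqP; rewrite mulf_eq0 (negPf nzS) (negPf nz).
  rewrite linearZ ecoordZ; have [->|nzT] := eqVneq (c T) 0; first by rewrite mul0r.
  have lt_TS : mon_lt T S by apply: maxS => //; rewrite inE TI.
  have [->|nz] := eqVneq (ecoord (ext_map A (w T)) S) 0; first by rewrite mulr0.
  case: (wP T TI) => _ [_ /(_ S nz)]; rewrite eq_sym => /(_ neTS) lt_ST.
  by have := mon_lt_trans lt_ST lt_TS; rewrite mon_lt_irr.
move=> lt_card.
have [c [[T1 T1X nzc] c0]] := kernel_comb (fun T S => ecoord (ext_map A (e T)) S) lt_card.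
pose g := \sum_(T in X) c T *: e T.
have gE T : ecoord g T = if T \in X then c T else 0.
  rewrite ecoord_sum big_mkcond (bigD1 T) //= big1 => [|R neRT].
    by rewrite addr0; case: ifP => // _; rewrite ecoordZ ecoord_basis eqxx mulr1.
  by case: ifP => // _; rewrite ecoordZ ecoord_basis eq_sym (negPf neRT) mulr0.
have [g0|nzAg] := eqVneq (ext_map A g) 0.
  have: g = 0 by rewrite -(ext_mapK uA g) g0 linear0.
  by move/(congr1 (fun f => ecoord f T1)); rewrite gE T1X ecoord0 => c10; rewrite c10 eqxx in nzc.
have [S Sini] := has_initial nzAg.
have SI : S \in initials (image_span A X).
  apply/initialsP; exists (ext_map A g) => //; exists g => // T.
  by rewrite gE; case: ifP; rewrite ?eqxx.
case: Sini => /negP[]; rewrite linear_sum ecoord_sum -[X in _ == X](c0 S SI); apply/eqP.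
by apply: eq_bigr => T _; rewrite linearZ ecoordZ.
Qed.

Lemma initials_subset A X Y : X \subset Y ->
  initials (image_span A X) \subset initials (image_span A Y).
Proof.
move=> sXY; apply/subsetP => S /initialsP[h [f fX ->] hS]; apply/initialsP.
by exists (ext_map A f) => //; exists f => // T /fX/(subsetP sXY).
Qed.

Lemma supported_mul X f g : (forall S T, S \in X -> S \subset T -> T \in X) ->
  supported X f -> supported X (f * g).
Proof.
move=> upX fX R; rewrite ext_mulE ecoord_sum => nz.
apply/negPn; apply: contraNN nz => RnX; apply/eqP; apply: big1 => S _.
rewrite ecoord_sum big1 // => T _; rewrite ecoordZ ebasis_mul ecoordZ ecoord_basis.
have [defR|_] := eqVneq; last by rewrite !mulr0.
have [->|/fX SX] := eqVneq (ecoord f S) 0; first by rewrite !mul0r.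
by rewrite defR (upX S) ?subsetUl in RnX.
Qed.

Lemma mon_ltU1 i S T : i \notin S -> i \notin T ->
  mon_lt T S -> mon_lt (i |: T) (i |: S).
Proof.
move=> iS iT /mon_ltP lt_TS; apply/mon_ltP; rewrite !cardsU1 iS iT /= ltn_add2l.
case: lt_TS => [|[->] [j [jT jS above]]]; first by left.
right; split=> //; exists j; rewrite !inE jT orbT negb_or jS andbT; split=> //.
  by apply: contraNneq iT => <-.
by move=> k /above; rewrite !inE => ->.
Qed.

(** If f has initial monomial S and i is not in S, then f e_i has initial
    monomial S with i added; A J(X) is closed under multiplication by e_i
    because J(X) is closed under multiplication by its preimage under A. *)
Lemma initials_up A X S T : A \in unitmx ->
  (forall S T, S \in X -> S \subset T -> T \in X) ->
  S \in initials (image_span A X) -> S \subset T ->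
  T \in initials (image_span A X).
Proof.
move=> uA upX SI sST; rewrite -(setUidPl sST) => {sST}.
elim/set_min_ind: T => [|i T _]; first by rewrite set0U.
rewrite -setUA; move: (T :|: S) => {SI}{}S SI.
have [iS|iS] := boolP (i \in S); first by rewrite (setUidPr _) ?sub1set.
case/initialsP: SI => h [f fX ->] [nz ltS]; apply/initialsP.
exists (ext_map A f * e [set i]).
  exists (f * ext_map (invmx A) (e [set i])); first exact: supported_mul.
  by rewrite ext_mapM ext_mapVK.
split.
  rewrite ecoord_mulr_vec setU11 setU1K // mulf_neq0 // esign_neq0 //.
  by rewrite disjoint_sym disjoints1.
move=> R; rewrite ecoord_mulr_vec; case: ifP => [iR|]; last by rewrite eqxx.
rewrite mulf_eq0 negb_or => /andP[_ nzR] neR; rewrite -(setD1K iR).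
apply: mon_ltU1; rewrite ?iS ?setD11 //; apply: ltS => //.
by apply: contraNneq neR => <-; rewrite setD1K.
Qed.

End Initials.

(** * Generic matrices *)

Section Genericity.
Local Open Scope ring_scope.
Variables (K : fieldType) (n : nat).
Local Notation E := (exterior K n).
Local Notation e := (ebasis K).
Implicit Types (X Y : {set {set 'I_n}}) (S T R : {set 'I_n}) (A B : 'M[K]_n).

Definition polyfun (F : 'M[K]_n -> K) : Prop :=
  exists p : {mpoly K[n * n]}, forall A, F A = p.@[mxvec A 0].

Lemma polyfun_ext F G : F =1 G -> polyfun G -> polyfun F.
Proof. by move=> eqFG [p Gp]; exists p => A; rewrite eqFG. Qed.

Lemma polyfun_const c : polyfun (fun=> c).
Proof. by exists c%:MP => A; rewrite mevalC. Qed.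

Lemma polyfun_entry i j : polyfun (fun A => A i j).
Proof. by exists 'X_(mxvec_index i j) => A; rewrite mevalXU mxvecE. Qed.

Lemma polyfunD F G : polyfun F -> polyfun G -> polyfun (fun A => F A + G A).
Proof. by move=> [p Fp] [q Gq]; exists (p + q) => A; rewrite mevalD Fp Gq. Qed.

Lemma polyfunM F G : polyfun F -> polyfun G -> polyfun (fun A => F A * G A).
Proof. by move=> [p Fp] [q Gq]; exists (p * q) => A; rewrite mevalM Fp Gq. Qed.

Lemma polyfun_sum I (r : seq I) (P : pred I) (F : I -> 'M[K]_n -> K) :
  (forall i, polyfun (F i)) -> polyfun (fun A => \sum_(i <- r | P i) F i A).
Proof.
move=> polyF; elim: r => [|i r IH].
  by apply: polyfun_ext (polyfun_const 0) => A; rewrite big_nil.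
case Pi: (P i).
  by apply: polyfun_ext (polyfunD (polyF i) IH) => A; rewrite big_cons Pi.
by apply: polyfun_ext IH => A; rewrite big_cons Pi.
Qed.

Lemma polyfun_prod I (r : seq I) (P : pred I) (F : I -> 'M[K]_n -> K) :
  (forall i, polyfun (F i)) -> polyfun (fun A => \prod_(i <- r | P i) F i A).
Proof.
move=> polyF; elim: r => [|i r IH].
  by apply: polyfun_ext (polyfun_const 1) => A; rewrite big_nil.
case Pi: (P i).
  by apply: polyfun_ext (polyfunM (polyF i) IH) => A; rewrite big_cons Pi.
by apply: polyfun_ext IH => A; rewrite big_cons Pi.
Qed.

Lemma polyfun_det m (M : 'M[K]_n -> 'M[K]_m) :
  (forall i j, polyfun (fun A => M A i j)) -> polyfun (fun A => \det (M A)).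
Proof.
move=> polyM; apply: polyfun_sum => s; apply: polyfunM; first exact: polyfun_const.
by apply: polyfun_prod => i.
Qed.

Lemma polyfun_form_prod S T : polyfun (fun A => ecoord (form_prod A S) T).
Proof.
rewrite /form_prod; move: (enum S) => s {S}; elim/last_ind: s T => [|s i IH] T.
  by apply: polyfun_ext (polyfun_const (ecoord (1 : E) T)) => A; rewrite big_nil.
pose G j A := A i j * if j \in T then
  esign K (T :\ j) [set j] * ecoord (\prod_(k <- s) row_form A k) (T :\ j) else 0.
apply: (@polyfun_ext _ (fun A => \sum_j G j A)) => [A|].
  rewrite -cats1 big_cat big_seq1 /= row_formM ecoord_sum; apply: eq_bigr => j _.
  by rewrite ecoordZ ecoord_mulr_vec.
apply: polyfun_sum => j; apply: polyfunM; first exact: polyfun_entry.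
case: (j \in T); last exact: polyfun_const.
by apply: polyfunM; [apply: polyfun_const|apply: IH].
Qed.

Definition spaced_sets p q : {set {set 'I_n}} :=
  [set T : {set 'I_n} | [&& #|T| == p, spaced 2 (enum T) &
     [forall i in T, (i < (q + p).-1)%N]]].

Definition low_sets p q : {set {set 'I_n}} :=
  [set S : {set 'I_n} | (#|S| == p) && [forall i in S, (i < q)%N]].

(** A block of the p-th compound matrix of A: these coordinates are the minors
    with rows in a spaced set and columns in a low set. *)
Definition minors p q A :=
  \matrix_(a < #|spaced_sets p q|, b < #|low_sets p q|)
     ecoord (form_prod A (enum_val a)) (enum_val b).

(** A vector in the right kernel is a functional on the p-th exterior power of
    K^q that kills the spaced products of points of the moment curve. *)
Lemma minors_vander (x : 'I_n -> K) p q :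
  injective x -> ((q + p).-1 <= n)%N -> row_full (minors p q (vander x)).
Proof.
move=> x_inj le_n; rewrite /row_full -mxrank_tr; apply: inj_row_free => v vM.
pose phi f : K^o := \sum_b v 0 b * ecoord f (enum_val b).
have phi_linear : linear phi.
  move=> a f g; rewrite /phi scaler_sumr -big_split /=; apply: eq_bigr => b _.
  by rewrite ecoordP mulrDr -[a *: _]/(a * _) !mulrA [a * _]mulrC.
pose phiL : {linear E -> K^o} := HB.pack phi (GRing.isLinear.Build _ _ _ _ phi phi_linear).
suff phi0 S : phiL (e S) = 0.
  apply/rowP=> b; rewrite mxE -[RHS](phi0 (enum_val b)) /= /phi (bigD1 b) //=.
  rewrite ecoord_basis eqxx mulr1 big1 ?addr0 // => b' neb.
  by rewrite ecoord_basis (inj_eq enum_val_inj) (negPf neb) mulr0.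
have low (b : 'I_#|low_sets p q|) :
    #|enum_val b| = p /\ forall i, i \in enum_val b -> (i < q)%N.
  by have := enum_valP b; rewrite inE => /andP[/eqP-> /forall_inP].
apply: (@vander_functional _ _ _ x_inj q p phiL [::]) => //.
- move=> R neR; rewrite /= /phi big1 // => b _; rewrite ecoord_basis.
  case: eqP => [defR|]; last by rewrite mulr0.
  by case: (low b) neR => + _; rewrite defR => ->; rewrite eqxx.
- move=> t size_t spt /allP allt.
  have enum_t : enum [set i in t] = t.
    apply: sorted_enum_set; apply: sub_sorted spt => i j; lia.
  have tS : [set i in t] \in spaced_sets p q.
    rewrite inE cardE enum_t size_t eqxx spt /=; apply/forall_inP => i.
    by rewrite inE => /allt.
  move/rowP/(_ (enum_rank_in tS [set i in t])): vM; rewrite !mxE => vMt.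
  rewrite -[RHS]vMt /= /phi; apply: eq_bigr => b _.
  by rewrite !mxE enum_rankK_in // /form_prod enum_t.
- move=> c u lec; rewrite /= /phi big1 // => b _; rewrite ecoord_mulr_vec.
  case: ifP => [/(proj2 (low b))|]; last by rewrite mulr0.
  by rewrite addn0 in lec; rewrite ltnNge lec.
Qed.

(** With B a left inverse at A0, the determinant of B times the block is a
    polynomial in A that equals 1 at A0. *)
Lemma minors_open p q A0 : row_full (minors p q A0) ->
  exists F, [/\ polyfun F, F A0 != 0 & forall A, F A != 0 -> row_full (minors p q A)].
Proof.
case/row_fullP => B BA0; exists (fun A => \det (B *m minors p q A)); split.
- apply: polyfun_det => i j.
  apply: (@polyfun_ext _ (fun A => \sum_a B i a * minors p q A a j)) => [A|].
    by rewrite mxE.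
  apply: polyfun_sum => a; apply: polyfunM; first exact: polyfun_const.
  apply: polyfun_ext (polyfun_form_prod (enum_val a) (enum_val j)) => A.
  by rewrite mxE.
- by rewrite BA0 det1 oner_eq0.
- move=> A; rewrite -unitfE -/(_ \in unitmx) => uBA; apply/row_fullP.
  by exists (invmx (B *m minors p q A) *m B); rewrite -mulmxA mulVmx.
Qed.

(** Full rank yields an element of A J(X) whose only low coordinate of degree p
    is on S.  Every other monomial in its support has the same degree and a
    vertex at or beyond q, hence is smaller in the reverse lexicographic
    order. *)
Lemma low_sets_initial p q A X : row_full (minors p q A) ->
  spaced_sets p q \subset X -> low_sets p q \subset initials (image_span A X).
Proof.
case/row_fullP => B BA /subsetP sX; apply/subsetP => S SL; apply/initialsP.
pose s := enum_rank_in SL S.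
pose f := \sum_a B s a *: e (enum_val a).
have Af : ext_map A f = \sum_a B s a *: form_prod A (enum_val a).
  by rewrite linear_sum; apply: eq_bigr => a _; rewrite linearZ /= ext_map_basis.
have fL R : R \in low_sets p q -> ecoord (ext_map A f) R = (R == S)%:R.
  move=> RL; move/matrixP/(_ s (enum_rank_in RL R)): BA; rewrite !mxE.
  rewrite Af ecoord_sum (_ : (_ == _) = (R == S)); last first.
    rewrite eq_sym; apply/eqP/eqP => [|defR].
      by move/(congr1 enum_val); rewrite !enum_rankK_in.
    by apply: enum_val_inj; rewrite !enum_rankK_in.
  by move <-; apply: eq_bigr => a _; rewrite ecoordZ mxE enum_rankK_in.
exists (ext_map A f); first exists f => // T.
  rewrite ecoord_sum => nz; apply: contraNT nz => TX; apply/eqP; apply: big1 => a _.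
  rewrite ecoordZ ecoord_basis; case: eqP TX => [->|]; last by rewrite mulr0.
  by rewrite sX ?enum_valP.
split=> [|T nzT neTS]; first by rewrite fL // eqxx oner_eq0.
move: (SL); rewrite inE => /andP[/eqP cardS /forall_inP lowS].
have cardT : #|T| = p.
  move: nzT; rewrite Af ecoord_sum => nz; apply/eqP; apply: contraNT nz => neT.
  apply/eqP; apply: big1 => a _; rewrite ecoordZ.
  have [->|/form_prod_homog cT] := eqVneq (ecoord (form_prod A (enum_val a)) T) 0.
    by rewrite mulr0.
  by have := enum_valP a; rewrite inE -cT (negPf neT).
have /forall_inPn[i0 i0T ge_i0] : ~~ [forall i in T, (i < q)%N].
  apply: contraL nzT => lowT; rewrite negbK fL ?(negPf neTS) //.
  by rewrite inE cardT eqxx.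
case: (@arg_maxnP _ i0 (mem T) val i0T) => i iT max_i.
have ge_i : (q <= i)%N by apply: leq_trans (max_i i0 i0T); rewrite leqNgt.
apply/mon_ltP; right; rewrite cardS; split=> //; exists i; split=> //.
  by apply: contraL ge_i => /lowS; rewrite -ltnNge.
move=> j lt_ij; have /negPf-> : j \notin T.
  by apply: contraL lt_ij => /max_i; rewrite -leqNgt.
apply/esym/negP => /lowS; rewrite ltnNge => /negP[].
by apply: leq_trans ge_i (ltnW lt_ij).
Qed.

Hypothesis K_infinite : forall s : seq K, exists x : K, x \notin s.

Lemma infinite_inj : exists x : 'I_n -> K, injective x.
Proof.
have [s [us size_s]] : exists s : seq K, uniq s /\ size s = n.
  elim: n => [|m [s [us <-]]]; first by exists [::].
  by have [x xs] := K_infinite s; exists (x :: s); rewrite /= xs us.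
exists (fun i => nth 0 s i) => i j /eqP; rewrite nth_uniq ?size_s ?ltn_ord //.
by move/eqP/val_inj.
Qed.

Lemma vander_unit (x : 'I_n -> K) : injective x -> vander x \in unitmx.
Proof.
move=> x_inj; have -> : vander x = (Vandermonde n (\row_i x i))^T.
  by apply/matrixP => i j; rewrite !mxE.
rewrite unitmx_tr unitmxE det_Vandermonde unitfE; apply/prodf_neq0 => i _.
apply/prodf_neq0 => j lt_ij; rewrite !mxE subr_eq0.
by apply: contraTneq lt_ij => /x_inj->; rewrite ltnn.
Qed.

(** One nonempty open set serves all p and q, because one Vandermonde matrix
    is a common nonzero of the finitely many polynomials. *)
Lemma generic_matrices : exists O : 'M[K]_n -> Prop,
  [/\ GL_open O, exists A, O A &
      forall A, O A -> A \in unitmx /\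
        forall p q, ((q + p).-1 <= n)%N -> (p <= n)%N -> (q <= n)%N ->
          row_full (minors p q A)].
Proof.
have [x x_inj] := infinite_inj.
have choice p q : exists F : 'M[K]_n -> K, [/\ polyfun F, F (vander x) != 0 &
    ((q + p).-1 <= n)%N -> forall A, F A != 0 -> row_full (minors p q A)].
  have [le_n|] := leqP (q + p).-1 n; last first.
    by exists (fun=> 1); split; rewrite ?oner_eq0 //; apply: polyfun_const.
  by have [F [FP F0 FA]] := minors_open (minors_vander x_inj le_n); exists F.
pose F p q := proj1_sig (constructive_indefinite_description _ (choice p q)).
have FP p q : [/\ polyfun (F p q), F p q (vander x) != 0 &
    ((q + p).-1 <= n)%N -> forall A, F p q A != 0 -> row_full (minors p q A)].
  by rewrite /F; case: constructive_indefinite_description.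
have [D D_eval] : polyfun (fun A => \prod_(p < n.+1) \prod_(q < n.+1) F p q A).
  by apply: polyfun_prod => p; apply: polyfun_prod => q; case: (FP p q).
exists (fun A => A \in unitmx /\ exists2 p, p = D & p.@[mxvec A 0] != 0); split.
- by exists (eq^~ D).
- exists (vander x); split; first exact: vander_unit.
  exists D => //; rewrite -D_eval; apply/prodf_neq0 => p _; apply/prodf_neq0 => q _.
  by case: (FP p q).
- move=> A [uA [_ -> nzD]]; split=> // p q le_n le_p le_q; case: (FP p q) => _ _; apply=> //.
  move: nzD; rewrite -D_eval => /prodf_neq0/(_ (Ordinal (le_p : (p < n.+1)%N)) isT).
  by move/prodf_neq0/(_ (Ordinal (le_q : (q < n.+1)%N)) isT).
Qed.

(** * Generic initial ideals and exterior shifting *)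

Lemma poly_line A B (p : {mpoly K[n * n]}) :
  exists P : {poly K}, forall t, P.[t] = p.@[mxvec (A + t *: (B - A)) 0].
Proof.
pose line i : {poly K} := (mxvec A 0 i)%:P + (mxvec (B - A) 0 i)%:P * 'X.
exists (mmap polyC line p) => t.
rewrite mevalE /mmap horner_sum; apply: eq_bigr => m _; rewrite hornerM hornerC.
congr (_ * _); rewrite /mmap1 horner_prod; apply: eq_bigr => i _.
rewrite horner_exp !hornerE; congr (_ ^+ _).
by rewrite (linearD _ A) (linearZ _ (B - A)) [in RHS]mxE [X in _ = _ + X]mxE mulrC.
Qed.

(** On the line joining a point of O1 to a point of O2, each of the three
    conditions (O1, O2 and invertibility) is the nonvanishing of a nonzero
    polynomial in one variable. *)
Lemma GL_open_meet (O1 O2 : 'M[K]_n -> Prop) :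
  GL_open O1 -> GL_open O2 -> (exists A, O1 A) -> (exists A, O2 A) ->
  exists A, O1 A /\ O2 A.
Proof.
move=> [P1 O1E] [P2 O2E] [A OA] [B OB].
have [uA [p1 P1p1 nz1]] := (O1E A).1 OA; have [_ [p2 P2p2 nz2]] := (O2E B).1 OB.
have [D D_eval] : polyfun (fun A => \det A) by apply: polyfun_det => i j; apply: polyfun_entry.
have [L1 L1E] := poly_line A B p1; have [L2 L2E] := poly_line A B p2.
have [L3 L3E] := poly_line A B D.
have nzL1 : L1 != 0.
  by apply: contraNneq nz1 => L0; move: (L1E 0); rewrite scale0r addr0 L0 horner0 => <-.
have nzL2 : L2 != 0.
  apply: contraNneq nz2 => L0; move: (L2E 1); rewrite scale1r addrC subrK.
  by rewrite L0 horner0 => <-.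
have nzL3 : L3 != 0.
  move: uA; rewrite unitmxE unitfE D_eval; apply: contraNneq => L0.
  by move: (L3E 0); rewrite scale0r addr0 L0 horner0 => <-.
pose L := L1 * L2 * L3.
have [t] : exists t, ~~ root L t.
  have [s us] : exists s : seq K, uniq s /\ (size L <= size s)%N.
    elim: (size _) => [|m [s [us le_s]]]; first by exists [::].
    have [x xs] := K_infinite s; exists (x :: s); rewrite /= xs us; split=> //.
  have [/max_poly_roots/(_ us.1)|/allPn[t _ rt]] := boolP (all (root L) s).
    by rewrite !mulf_neq0 // => /(_ isT); rewrite ltnNge us.2.
  by exists t.
rewrite /L !rootM !negb_or /root L1E L2E L3E.
case/andP=> /andP[n1 n2] n3; exists (A + t *: (B - A)).
have uC : A + t *: (B - A) \in unitmx by rewrite unitmxE unitfE D_eval.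
by split; [apply/O1E|apply/O2E]; split=> //; [exists p1|exists p2].
Qed.

Lemma is_Gin_unique (J I1 I2 : E -> Prop) :
  is_Gin J I1 -> is_Gin J I2 -> forall g, I1 g <-> I2 g.
Proof.
move=> [O1 [open1 ne1 G1]] [O2 [open2 ne2 G2]] g.
have [A [O1A O2A]] := GL_open_meet open1 open2 ne1 ne2.
by rewrite -(G1 A O1A) -(G2 A O2A).
Qed.

Lemma ideal_gen_ext (R : nzRingType) (G H : R -> Prop) :
  (forall g, G g <-> H g) -> forall f, ideal_gen G f <-> ideal_gen H f.
Proof. by move=> GH f; split=> -[s [sG ->]]; exists s; split=> // t /sG/GH. Qed.

Lemma ext_face_idealP (Gamma : {set {set 'I_n}}) (f : E) : is_complex Gamma ->
  ext_face_ideal Gamma f <-> supported (~: Gamma) f.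
Proof.
move=> cG; split=> [[s [sG ->]] S|fG].
  rewrite ecoord_sum => nz.
  have [t ts nzt] : exists2 t, t \in s & ecoord (t.1.1 * t.1.2 * t.2) S != 0.
    apply/hasP; apply: contraNT nz => /hasPn z; rewrite big1_seq // => t /andP[_ /z].
    by rewrite negbK => /eqP.
  have upG R T : R \in ~: Gamma -> R \subset T -> T \in ~: Gamma.
    by rewrite !inE => RG sRT; apply: contra RG => /cG; apply.
  move: nzt; apply: supported_mul => //; case: (sG t ts) => T TG -> R.
  rewrite ext_mulE ecoord_sum => {}nz.
  apply/negPn; apply: contraNN nz => RnX; apply/eqP; apply: big1 => S' _.
  rewrite ecoord_sum big1 // => T' _; rewrite ecoordZ ebasis_mul ecoordZ !ecoord_basis.
  have [eT|_] := eqVneq T' T; last by rewrite mulr0 mul0r.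
  have [defR|_] := eqVneq; last by rewrite !mulr0.
  by rewrite (upG T) ?inE // defR eT subsetUr in RnX.
exists [seq (ecoord f T *: (1 : E), e T, 1) | T <- enum (~: Gamma)]; split.
  by move=> _ /mapP[S + ->] /=; rewrite mem_enum inE => SG; exists S.
rewrite {1}(supportedE fG) big_map big_enum /=; apply: eq_bigr => S _.
by rewrite ext_scaleAl mul1r mulr1.
Qed.

Lemma initial_idealE (J : E -> Prop) (X : {set {set 'I_n}}) g :
  initials J = X ->
  initial_ideal J g <-> ideal_gen (fun h => exists2 S, S \in X & h = e S) g.
Proof.
move=> <-; apply: ideal_gen_ext => h; split=> [[f [S [Jf fS ->]]]|[S]].
  by exists S => //; apply/initialsP; exists f.
by case/initialsP=> f Jf fS ->; exists f, S.
Qed.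

(** The ideal and the complex selected by the epsilon operator are determined:
    the former by [is_Gin_unique], the latter because a complex consists of
    the S with e_S outside its face ideal. *)
Lemma ext_shifting_eq (Gamma Delta : {set {set 'I_n}}) (O : 'M[K]_n -> Prop) :
  is_complex Gamma -> is_complex Delta -> GL_open O -> (exists A, O A) ->
  (forall A, O A -> initials (image_span A (~: Gamma)) = ~: Delta) ->
  ext_shifting K Gamma = Delta.
Proof.
move=> cG cD openO neO OD.
have GinD : is_Gin (ext_face_ideal (K := K) Gamma) (ext_face_ideal Delta).
  exists O; split=> // A OA g.
  have J_eq : initials (fun h => exists2 f, ext_face_ideal Gamma f & h = ext_map A f) = ~: Delta.
    rewrite -(OD A OA); apply/setP => S; apply/initialsP/initialsP => -[f].
      by case=> f0 /(ext_face_idealP _ cG) f0G -> fS; exists (ext_map A f0) => //; exists f0.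
    by case=> f0 f0G -> fS; exists (ext_map A f0) => //; exists f0 => //; apply/ext_face_idealP.
  rewrite (initial_idealE g J_eq); apply: ideal_gen_ext => h.
  by split=> -[S SD ->]; exists S => //; move: SD; rewrite inE.
have GinE := epsilon_spec (inhabits (ext_face_ideal (K := K) Gamma)) _ (ex_intro _ _ GinD).
have shiftD : is_ext_shifting K Gamma Delta.
  by split=> // f; apply: is_Gin_unique GinD GinE f.
have [cS shiftE] := epsilon_spec (inhabits set0) _ (ex_intro _ _ shiftD).
rewrite -/(ext_shifting K Gamma) in cS shiftE *.
have eD f : ext_face_ideal (K := K) (ext_shifting K Gamma) f <-> ext_face_ideal Delta f.
  by rewrite shiftE -(shiftD.2 f).
have memE (C : {set {set 'I_n}}) S : is_complex C -> ext_face_ideal C (e S) <-> S \notin C.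
  move=> cC; rewrite ext_face_idealP //; split=> [/(_ S)|SC T].
    by rewrite ecoord_basis eqxx oner_eq0 inE; apply.
  by rewrite ecoord_basis inE; have [->|_] := eqVneq T S; rewrite ?eqxx.
apply/setP => S; apply: negb_inj; apply/idP/idP => hS.
  by apply/memE => //; apply/eD/memE.
by apply/memE => //; apply/eD/memE.
Qed.

End Genericity.

(** * Greedy spaced sequences in words *)

Section Greedy.
Implicit Types (a s k q r x : nat) (w : seq bool) (t : seq nat).

(** Positions, counted from k, of the greedily chosen letters [true] of w, where
    s letters are still to be skipped and each choice skips a - 1 letters. *)
Fixpoint greedy a s k w : seq nat :=
  if w is b :: w' then
    if s is s'.+1 then greedy a s' k.+1 w'
    else if b then k :: greedy a a.-1 k.+1 w' else greedy a 0 k.+1 w'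
  else [::].

(** The word left when the skipped letters are deleted.  The r-th greedy
    position moves down by (a-1) r, which turns bounds on greedy positions into
    counts of letters in a prefix, as in [count_contract]. *)
Fixpoint contract a s w : seq bool :=
  if w is b :: w' then
    if s is s'.+1 then contract a s' w'
    else b :: contract a (if b then a.-1 else 0) w'
  else [::].

Definition gapped a t := sorted (fun x y => x + a <= y) t.

Lemma gapped_nth a t i j : gapped a t -> i <= j -> j < size t ->
  nth 0 t i + a * (j - i) <= nth 0 t j.
Proof.
move=> /(sortedP 0) spt le_ij; rewrite -(subnKC le_ij); move: (j - i) => {le_ij}d.
elim: d => [|d IH] lt_d; first by rewrite addn0; lia.
have := spt (i + d); rewrite -addnS => /(_ lt_d); have := IH; lia.
Qed.

Lemma gapped_mono a t i j : gapped a t -> i <= j -> j < size t ->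
  nth 0 t i <= nth 0 t j.
Proof. by move=> gt le_ij /(gapped_nth gt le_ij); apply: leq_trans; apply: leq_addr. Qed.

Lemma greedy_mem a s k w x : x \in greedy a s k w ->
  [/\ k + s <= x, x < k + size w & nth false w (x - k)].
Proof.
elim: w s k => //= b w IH s k xg.
have [[-> [-> Db]]|[s' [/IH[ge_x lt_x nth_x] le_ss']]] :
    (x = k /\ s = 0 /\ b) \/ exists s', x \in greedy a s' k.+1 w /\ s <= s'.+1.
- case: s xg => [|s] xg; last by right; exists s.
  case: b xg => xg; last by right; exists 0.
  by move: xg; rewrite inE => /predU1P[->|xg]; [left | right; exists a.-1].
- by rewrite subnn; split=> //; lia.
have -> : x - k = (x - k.+1).+1 by lia.
by split=> //; lia.
Qed.

Lemma greedy_gapped a s k w : gapped a (greedy a s k w).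
Proof.
elim: w s k => //= b w IH [|s] k //; case: b => //.
rewrite /gapped /= path_min_sorted; first exact: IH; apply/allP => x /greedy_mem[]; lia.
Qed.

Lemma greedy_cover a s k w i : 0 < a -> s <= i -> nth false w i ->
  exists2 g, g \in greedy a s k w & g <= k + i < g + a.
Proof.
move=> a_gt0; elim: w s k i => [|b w IH] s k i; first by rewrite nth_nil.
case: s => [|s] /=; last first.
  by case: i => // i le_si /(IH s k.+1 i le_si); rewrite addSnnS.
case: b i => [] [|i] //= _ wi.
- by exists k; rewrite ?mem_head // addn0; lia.
- have [lt_ia|le_ai] := ltnP i a.-1; first by exists k; rewrite ?mem_head //; lia.
  have [g gG bd] := IH _ k.+1 _ le_ai wi.
  by exists g; rewrite ?inE ?gG ?orbT // -addSnnS.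
- by rewrite -addSnnS; apply: IH.
Qed.

Lemma greedy_nth_ge a s k w r : r < size (greedy a s k w) ->
  k + s + a * r <= nth 0 (greedy a s k w) r.
Proof.
move=> lt_r; have := gapped_nth (greedy_gapped a s k w) (leq0n r) lt_r.
have: nth 0 (greedy a s k w) 0 \in greedy a s k w by apply: mem_nth; apply: leq_ltn_trans lt_r.
by case/greedy_mem; lia.
Qed.

Lemma count_contract a s k w q r : 0 < a ->
  (r < count id (take q (contract a s w))) =
  (r < size (greedy a s k w)) &&
    (nth 0 (greedy a s k w) r < q + k + s + a.-1 * r).
Proof.
move=> a_gt0; elim: w s k q r => [|b w IH] s k q r; first by case: q.
case: s => [|s]; last by rewrite (IH s k.+1); congr (_ && (_ < _)) => /=; lia.
case: q => [|q].
  apply/esym/negP => /andP[/greedy_nth_ge]; have : a.-1 * r <= a * r by nia.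
  lia.
case: b => /=; last by rewrite (IH 0 k.+1); congr (_ && (_ < _)); lia.
case: r => [|r] /=; first by rewrite add1n ltnS leq0n; lia.
rewrite add1n ltnS (IH _ k.+1); congr (_ && (_ < _)); nia.
Qed.

(** Each term of t lies in one of the disjoint intervals [g, g + a) with g
    greedy, and distinct terms lie in distinct intervals. *)
Lemma greedy_min a w t : 0 < a -> gapped a t -> (forall x, x \in t -> nth false w x) ->
  size t <= size (greedy a 0 0 w) /\
  forall r, r < size t -> nth 0 (greedy a 0 0 w) r <= nth 0 t r.
Proof.
move=> a_gt0 gt tw; set g := greedy a 0 0 w.
have gg : gapped a g := greedy_gapped a 0 0 w.
have block r : r < size t -> exists c, [/\ r <= c, c < size g &
    nth 0 g c <= nth 0 t r < nth 0 g c + a].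
  elim: r => [|r IH] lt_r.
    have [x xg bd] := @greedy_cover a 0 0 w _ a_gt0 (leq0n _) (tw _ (mem_nth 0 lt_r)).
    by exists (index x g); rewrite index_mem nth_index.
  have [c [le_rc lt_c bdc]] := IH (ltnW lt_r).
  have [x xg] := @greedy_cover a 0 0 w _ a_gt0 (leq0n _) (tw _ (mem_nth 0 lt_r)).
  rewrite -/g in xg; rewrite -(nth_index 0 xg); set c' := index x g => bdc'.
  have lt_c' : c' < size g by rewrite index_mem.
  exists c'; split=> //; rewrite ltnNge; apply/negP => le_c'r.
  have := gapped_mono gg (leq_trans le_c'r le_rc) lt_c.
  have := gapped_nth gt (leqnSn r) lt_r; rewrite subSnn muln1 add0n in bdc' *.
  by rewrite /= in bdc' *; lia.
have le_g r : r < size t -> r < size g /\ nth 0 g r <= nth 0 t r.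
  move=> /block[c [le_rc lt_c bd]]; split; first exact: leq_ltn_trans lt_c.
  by have := gapped_mono gg le_rc lt_c; lia.
split=> [|r /le_g[]//].
by case: (size t) (le_g) => // r /(_ r (ltnSn r))[].
Qed.

(** [contract 2 0 w] followed by the deleted letters in reverse order; peeling
    letters off both ends makes injectivity an immediate induction. *)
Fixpoint fold_word w : seq bool :=
  match w with
  | true :: b :: w' => true :: rcons (fold_word w') b
  | b :: w' => b :: fold_word w'
  | [::] => [::]
  end.

Lemma word_ind2 (P : seq bool -> Prop) :
  P [::] -> (forall w, P w -> P (false :: w)) -> P [:: true] ->
  (forall b w, P w -> P [:: true, b & w]) -> forall w, P w.
Proof.
move=> P0 Pf P1 Pt w; have [m] := ubnP (size w); elim: m w => // m IH.
case=> [|[] [|b w]] //= lt_w; [apply: Pt | apply: Pf|apply: Pf]; apply: IH => /=; lia.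
Qed.

Lemma size_fold_word w : size (fold_word w) = size w.
Proof. by elim/word_ind2: w => //= [w -> | b w IH] //; rewrite size_rcons IH. Qed.

Lemma fold_word_inj : injective fold_word.
Proof.
move=> w; elim/word_ind2: w => [|w IH||b w IH] v eq_f; move: (congr1 size eq_f);
  rewrite !size_fold_word; case: v eq_f => [|[] [|c v]] //=.
- by move=> + /eqP; rewrite eqSS => + /nilP->.
- by case=> /(IH (c :: v))->.
- by case=> /rcons_inj[/IH-> ->].
Qed.

Lemma fold_wordE w : exists2 v, fold_word w = contract 2 0 w ++ v &
  size v <= count id (contract 2 0 w).
Proof.
elim/word_ind2: w => [|w [v Ew le_v]||b w [v Ew le_v]]; try by exists [::].
  by exists v; rewrite //= Ew.
exists (rcons v b); rewrite /=; first by rewrite Ew rcons_cat.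
by rewrite size_rcons add1n.
Qed.

Lemma contract1 w : contract 1 0 w = w.
Proof. by elim: w => //= b w IH; rewrite if_same IH. Qed.

(** Counts can differ only if the prefix reaches the deleted letters.  Then at
    least p letters are deleted, and each one follows its own letter [true] of
    the contracted word, so both counts are at least p. *)
Lemma count_fold_word p q w : (q + p).-1 <= size w ->
  (p <= count id (take q (contract 2 0 w))) = (p <= count id (take q (fold_word w))).
Proof.
have [v def_f le_v] := fold_wordE w.
have : size (contract 2 0 w) + size v = size w by rewrite -size_cat -def_f size_fold_word.
rewrite def_f take_cat; case: ltnP => // le_q size_w le_w.
rewrite take_oversize // count_cat.
have [->|p_gt0] := posnP p; first by rewrite !leq0n.
have [eq_q|] := eqVneq q (size (contract 2 0 w)).
  by rewrite eq_q subnn take0 addn0.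
lia.
Qed.

End Greedy.

(** * Sets containing spaced sequences *)

Section SpacedSets.
Variable n : nat.
Implicit Types (S T : {set 'I_n}) (a p q r : nat).

Definition word S : seq bool := [seq i \in S | i <- enum 'I_n].

Lemma size_word S : size (word S) = n.
Proof. by rewrite size_map size_enum_ord. Qed.

Lemma nth_word S (i : 'I_n) : nth false (word S) i = (i \in S).
Proof. by rewrite (nth_map i) ?size_enum_ord // nth_ord_enum. Qed.

Definition greedy_set a S := greedy a 0 0 (word S).

Lemma greedy_setP a S x : x \in greedy_set a S -> exists2 i : 'I_n, i \in S & x = i.
Proof.
case/greedy_mem=> _; rewrite add0n size_word subn0 => lt_x.
by rewrite (nth_word S (Ordinal lt_x)); exists (Ordinal lt_x).
Qed.

(** The sets containing an a-spaced sequence of length p inside the first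
    q + (a-1)(p-1) positions; see [has_spacedP] and [has_spaced_gapped]. *)
Definition has_spaced a p q : {set {set 'I_n}} :=
  [set S | p <= count id (take q (contract a 0 (word S)))].

Lemma has_spaced0 a q S : S \in has_spaced a 0 q. Proof. by rewrite inE. Qed.

Lemma has_spacedP a r q S : 0 < a ->
  (S \in has_spaced a r.+1 q) =
    (r < size (greedy_set a S)) && (nth 0 (greedy_set a S) r < q + a.-1 * r).
Proof. by move=> a_gt0; rewrite inE (@count_contract a 0 0) // !addn0. Qed.

Lemma has_spaced_gapped a r q S t : 0 < a -> gapped a t ->
  (forall x, x \in t -> exists2 i : 'I_n, i \in S & x = i) ->
  r < size t -> nth 0 t r < q + a.-1 * r -> S \in has_spaced a r.+1 q.
Proof.
move=> a_gt0 gt tS lt_r lt_q; rewrite has_spacedP //.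
have [|le_size le_nth] := @greedy_min a (word S) t a_gt0 gt.
  by move=> x /tS[i iS ->]; rewrite nth_word.
by rewrite (leq_trans lt_r) //= (leq_ltn_trans (le_nth r lt_r)).
Qed.

Lemma has_spaced_up a p q S T : 0 < a ->
  S \in has_spaced a p q -> S \subset T -> T \in has_spaced a p q.
Proof.
case: p => [|r] a_gt0; first by rewrite !has_spaced0.
rewrite {1}has_spacedP // => /andP[lt_r lt_q] sST.
apply: (has_spaced_gapped a_gt0 (greedy_gapped _ _ _ _) _ lt_r lt_q).
by move=> x /greedy_setP[i /(subsetP sST) iT ->]; exists i.
Qed.

Lemma spaced_sets_has_spaced p q : spaced_sets n p q \subset has_spaced 2 p q.
Proof.
apply/subsetP => T; rewrite inE => /and3P[/eqP cardT spT /forall_inP lowT].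
case: p cardT lowT => [|r] cardT lowT; first exact: has_spaced0.
have size_t : size (map val (enum T)) = r.+1 by rewrite size_map -cardE.
have mem_t x : x \in map val (enum T) -> exists2 i : 'I_n, i \in T & x = i.
  by case/mapP=> i; rewrite mem_enum; exists i.
apply: (@has_spaced_gapped 2 r q T (map val (enum T))) => //; rewrite ?size_t //.
  by rewrite /gapped sorted_map.
have /mem_t[i /lowT + ->] : nth 0 (map val (enum T)) r \in map val (enum T).
  by rewrite mem_nth ?size_t.
by rewrite /= mul1n addnS.
Qed.

Lemma has_spaced1_low p q S : S \in has_spaced 1 p q ->
  exists2 P, P \in low_sets n p q & P \subset S.
Proof.
case: p => [_|r].
  exists set0; last exact: sub0set.
  by rewrite inE cards0 eqxx; apply/forall_inP => i; rewrite inE.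
rewrite has_spacedP // => /andP[lt_r lt_q]; pose g := take r.+1 (greedy_set 1 S).
have size_g : size g = r.+1 by rewrite size_takel.
have nth_g j : j < r.+1 -> nth 0 g j = nth 0 (greedy_set 1 S) j by move=> lt_j; rewrite nth_take.
have gg := greedy_gapped 1 0 0 (word S).
have uniq_g : uniq g.
  apply: take_uniq; apply: (sorted_uniq ltn_trans ltnn).
  by apply: sub_sorted gg => x y; rewrite addn1.
have gS x : x \in g -> exists2 i : 'I_n, i \in S & x = i.
  by move/mem_take/greedy_setP.
exists [set i in S | val i \in g]; last by apply/subsetP => i; rewrite inE => /andP[].
rewrite inE; apply/andP; split.
  rewrite cardE -(size_map val) -size_g; apply/eqP/perm_size/uniq_perm => //.
    by rewrite (map_inj_uniq val_inj) enum_uniq.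
  move=> x; apply/mapP/idP => [[i]|xg]; first by rewrite mem_enum inE => /andP[_ ig] ->.
  have [i iS def_x] := gS x xg; exists i => //.
  by rewrite mem_enum inE iS /= -def_x.
apply/forall_inP => i; rewrite inE => /andP[_ ig].
rewrite -(nth_index 0 ig); have : index (val i) g < r.+1 by rewrite -size_g index_mem.
move=> lt_i; rewrite nth_g //.
by rewrite mul0n addn0 in lt_q; apply: leq_ltn_trans lt_q; apply: gapped_mono gg _ lt_r.
Qed.

Definition fold_set S : {set 'I_n} := [set i : 'I_n | nth false (fold_word (word S)) i].

Lemma word_fold_set S : word (fold_set S) = fold_word (word S).
Proof.
apply: (@eq_from_nth _ false); first by rewrite size_fold_word !size_word.
by move=> i; rewrite size_word => lt_i; rewrite (nth_word _ (Ordinal lt_i)) inE.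
Qed.

Lemma word_inj : injective word.
Proof. by move=> S T eq_w; apply/setP => i; rewrite -!nth_word eq_w. Qed.

Lemma fold_set_inj : injective fold_set.
Proof.
move=> S T eq_f; apply: word_inj; apply: fold_word_inj.
by rewrite -!word_fold_set eq_f.
Qed.

Lemma fold_set_has_spaced p q S : (q + p).-1 <= n ->
  (fold_set S \in has_spaced 1 p q) = (S \in has_spaced 2 p q).
Proof.
by move=> le_n; rewrite !inE contract1 word_fold_set count_fold_word ?size_word.
Qed.

End SpacedSets.

(** * Initial monomials for a generic matrix *)

Section GenericInitials.
Variables (K : fieldType) (n : nat) (A : 'M[K]_n).
Hypothesis A_unit : (A \in unitmx)%R.
Hypothesis A_generic : forall p q, (q + p).-1 <= n -> p <= n -> q <= n ->
  row_full (minors p q A).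
Implicit Types (S T : {set 'I_n}) (X Y : {set {set 'I_n}}) (c : nat * nat).

(** The bound on q + p - 1 says that the window of a 2-spaced sequence fits
    in [n]. *)
Definition admissible c := [&& (c.2 + c.1).-1 <= n, c.1 <= n & c.2 <= n].

Definition has_all_spaced a (cs : seq (nat * nat)) : {set {set 'I_n}} :=
  [set S | all (fun c => S \in has_spaced n a c.1 c.2) cs].

Lemma card_fold_preim X Y : (forall S, (fold_set S \in Y) = (S \in X)) -> #|X| = #|Y|.
Proof.
move=> foldXY; have -> : X = @fold_set n @^-1: Y by apply/setP => S; rewrite inE foldXY.
apply: on_card_preimset; exists (invF (@fold_set_inj n)) => S _; first exact: invF_f.
exact: f_invF.
Qed.

(** Both sides have the same number of elements, and the right side is the
    up-set generated by the low sets. *)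
Lemma initials_has_spaced c : admissible c ->
  initials (image_span A (has_spaced n 2 c.1 c.2)) = has_spaced n 1 c.1 c.2.
Proof.
case: c => p q /and3P[/= le_n le_p le_q]; apply/esym/eqP; rewrite eqEcard.
rewrite card_initials // (@card_fold_preim _ (has_spaced n 1 p q)) ?leqnn ?andbT; last first.
  by move=> S; rewrite fold_set_has_spaced.
apply/subsetP => S /has_spaced1_low[P lowP sPS]; apply: initials_up sPS => //.
  by move=> R T; apply: has_spaced_up.
apply: (subsetP (low_sets_initial (A_generic le_n le_p le_q) _)) lowP.
exact: spaced_sets_has_spaced.
Qed.

Lemma fold_has_all_spaced cs S : all admissible cs ->
  (fold_set S \in has_all_spaced 1 cs) = (S \in has_all_spaced 2 cs).
Proof.
move=> /allP adm; rewrite !inE; apply: eq_in_all => c /adm/and3P[le_n _ _].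
exact: fold_set_has_spaced.
Qed.

(** Monotonicity gives one inclusion and counting the equality. *)
Lemma initials_has_all_spaced cs : all admissible cs ->
  initials (image_span A (has_all_spaced 2 cs)) = has_all_spaced 1 cs.
Proof.
move=> adm; apply/eqP; rewrite eqEcard card_initials //.
rewrite (@card_fold_preim (has_all_spaced 2 cs) (has_all_spaced 1 cs)) ?leqnn ?andbT; last first.
  by move=> S; apply: fold_has_all_spaced.
apply/subsetP => S SI; rewrite inE; apply/allP => c ccs.
rewrite -initials_has_spaced ?(allP adm) //; move: S SI; apply/subsetP.
by apply: initials_subset; apply/subsetP => T; rewrite inE => /allP; apply.
Qed.

(** Here monotonicity gives the other inclusion. *)
Lemma initials_join_has_spaced (F : seq (nat * nat) -> Prop) X1 X2 :
  (forall cs, F cs -> all admissible cs) ->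
  (forall S, S \in X1 <-> exists2 cs, F cs & S \in has_all_spaced 1 cs) ->
  (forall S, S \in X2 <-> exists2 cs, F cs & S \in has_all_spaced 2 cs) ->
  initials (image_span A X2) = X1.
Proof.
move=> adm X1E X2E; apply/esym/eqP; rewrite eqEcard card_initials //.
rewrite (@card_fold_preim X2 X1) ?leqnn ?andbT; last first.
  move=> S; apply/idP/idP => [/X1E|/X2E] [cs Fcs Scs]; [apply/X2E|apply/X1E]; exists cs => //.
    by rewrite -fold_has_all_spaced ?adm.
  by rewrite fold_has_all_spaced ?adm.
apply/subsetP => S /X1E[cs Fcs]; rewrite -initials_has_all_spaced ?adm //.
apply/subsetP/initials_subset/subsetP => T Tcs.
by apply/X2E; exists cs.
Qed.

End GenericInitials.

(** * Monomials and their index sequences *)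

Section Indices.
Variable m : nat.
Implicit Types (u v : 'X_{1..m}) (s t : seq nat).

Lemma count_indices u (i : 'I_m) : count_mem i.+1 (indices u) = u i.
Proof.
rewrite /indices count_flatten -map_comp sumnE big_map big_enum (bigD1 i) //=.
rewrite count_nseq /= eqxx mul1n big1 ?addn0 // => j neji.
by rewrite count_nseq /= eqSS val_eqE (negPf neji).
Qed.

Lemma indices_bound u x : x \in indices u -> 0 < x <= m.
Proof. by case/flatten_mapP=> i _ /nseqP[-> _]; rewrite ltn_ord. Qed.

Lemma size_indices u : size (indices u) = mdeg u.
Proof.
rewrite /indices size_flatten /shape -map_comp sumnE big_map big_enum mdegE.
by apply: eq_bigr => i _; rewrite /= size_nseq.
Qed.

Lemma indices_sorted u : sorted leq (indices u).
Proof.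
have tr : transitive (fun i j : 'I_m => i < j) by move=> j i k; apply: ltn_trans.
rewrite (sorted_pairwise leq_trans) /indices; have := enum_ord_sorted [set: 'I_m].
have -> : enum [set: 'I_m] = enum 'I_m by apply: eq_enum => i; rewrite !inE.
rewrite (sorted_pairwise tr).
elim: (enum _) => //= i s IH /andP[lt_i /IH{}IH]; rewrite pairwise_cat IH andbT.
apply/andP; split.
  apply/allrelP => _ _ /nseqP[-> _] /flatten_mapP[j /(allP lt_i) lt_ij /nseqP[-> _]].
  by rewrite ltnW.
by apply/(pairwiseP 0) => j k; rewrite !inE size_nseq => lt_j lt_k _; rewrite !nth_nseq lt_j lt_k.
Qed.

Definition index_seq s := sorted leq s /\ forall x, x \in s -> 0 < x <= m.

Lemma indices_index_seq u : index_seq (indices u).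
Proof. by split; [apply: indices_sorted | move=> x; apply: indices_bound]. Qed.

Lemma index_seq_subseq s t : subseq t s -> index_seq s -> index_seq t.
Proof.
move=> sub_ts [srt bd]; split; first exact: (subseq_sorted leq_trans sub_ts).
by move=> x /(mem_subseq sub_ts)/bd.
Qed.

Lemma count_monomial_of s (i : 'I_m) : monomial_of m s i = count_mem i.+1 s.
Proof. by rewrite mnmE. Qed.

Lemma indicesK u : monomial_of m (indices u) = u.
Proof. by apply/mnmP => i; rewrite count_monomial_of count_indices. Qed.

Lemma monomial_ofK s : index_seq s -> indices (monomial_of m s) = s.
Proof.
case=> srt bd; apply: (sorted_eq leq_trans anti_leq) => //; first exact: indices_sorted.
apply/allP => x _ /=; have [bx|nbx] := boolP (0 < x <= m).
  case: x bx => // x lt_x; have := count_indices (monomial_of m s) (Ordinal lt_x).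
  by rewrite count_monomial_of => ->.
rewrite !(count_memPn _) //; first by apply: contra nbx => /bd.
by apply: contra nbx => /indices_bound.
Qed.

End Indices.

Lemma index_seq_le m m' s : m <= m' -> index_seq m s -> index_seq m' s.
Proof.
move=> le_mm [srt bd]; split=> // x /bd/andP[-> le_x]; exact: leq_trans le_mm.
Qed.

Lemma subseq_nth_le s t r : sorted leq s -> subseq t s -> r < size t ->
  nth 0 s r <= nth 0 t r.
Proof.
elim: s t r => [|x s IH] [|y t] r //= srt; have {}IH := IH _ _ (path_sorted srt).
case: eqP => [->|_] sub_t; case: r => [|r] //= lt_r.
- exact: IH sub_t lt_r.
- have := order_path_min leq_trans srt => /allP; apply.
  by apply: (mem_subseq sub_t); rewrite mem_head.
- apply: leq_trans (IH _ r.+1 sub_t lt_r); move/(pathP 0): srt; apply.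
  by have := size_subseq sub_t; rewrite /= => /(leq_ltn_trans _)->.
Qed.

Lemma index_seq_nth m s r : index_seq m s -> r < size s -> 0 < nth 0 s r <= m.
Proof. by move=> [_ bd] lt_r; apply/bd/mem_nth. Qed.

(** * Nonfaces of the complexes attached to a shifted order ideal *)

Section OrderIdeal.
Variables (m : nat) (U : {fset 'X_{1..m}}).
Hypothesis U_shifted : shifted_order_ideal U.
Implicit Types (u v : 'X_{1..m}) (s t : seq nat).

Lemma monomial_of_le k s t : subseq t s -> (monomial_of k t <= monomial_of k s)%MM.
Proof.
by move=> sub_ts; apply/mnm_lepP => i; rewrite !mnmE; apply: leq_count_subseq.
Qed.

Lemma order_ideal_prefix u k : u \in U -> monomial_of m (take k (indices u)) \in U.
Proof.
case: U_shifted => _ Udiv _ uU; apply: Udiv uU _.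
by rewrite -[X in (_ <= X)%MM](indicesK u) monomial_of_le // take_subseq.
Qed.

Lemma order_ideal_shift s t : index_seq m s -> index_seq m t -> size s = size t ->
  (forall r, r < size s -> nth 0 s r <= nth 0 t r) ->
  monomial_of m s \in U -> monomial_of m t \in U.
Proof.
case: U_shifted => _ _ Ushift s_ind t_ind eq_size le_st sU; apply: Ushift sU _.
rewrite /mon_prec -!size_indices !monomial_ofK // eq_size eqxx /=.
rewrite all2E eq_size eqxx /=; apply/(all_nthP (0, 0)) => r.
rewrite size_zip eq_size minnn => lt_r; rewrite nth_zip //=.
by apply: le_st; rewrite eq_size.
Qed.

Variables (n delta : nat).
Hypothesis U_degree : degree_at_most delta U.
Implicit Types (S T : {set 'I_n}).

(** Blocks of length a starting at i_r - 1 + a r, and a final segment. *)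
Definition facet a u : {set 'I_n} :=
  let s := indices u in
  [set x : 'I_n | [exists r : 'I_(size s),
       (nth 0 s r).-1 + a * r <= x < (nth 0 s r).-1 + a * r + a]
     || (m + a * size s <= x)].

Definition facet_complex a := gen_complex [set facet a (fsval u) | u : U].

(** T satisfies these constraints when its greedy positions are at most
    s_r - 1 + a r for all r. *)
Definition constraints s : seq (nat * nat) :=
  [seq (r.+1, nth 0 s r + r) | r <- iota 0 (size s)].

(** The degree bound keeps the constraints admissible.  It loses no nonface: a
    prefix of degree delta + 1 of a longer monomial is already outside U. *)
Definition forbidden (cs : seq (nat * nat)) : Prop :=
  exists u, [/\ u \notin U, size (indices u) <= delta.+1 & cs = constraints (indices u)].

Lemma meet_constraintsP a s T : reflect
  (forall r, r < size s -> T \in has_spaced n a r.+1 (nth 0 s r + r))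
  (T \in has_all_spaced n a (constraints s)).
Proof.
rewrite inE; apply: (iffP allP) => [dT r lt_r|dT _ /mapP[r + ->]].
  by apply: (dT (r.+1, nth 0 s r + r)); apply: map_f; rewrite mem_iota.
by rewrite mem_iota => lt_r; apply: dT.
Qed.

(** If T lies in the facet of u0, its r-th greedy position cannot precede the
    r-th block, and a greedy position after the last block would lie in the
    final segment, out of reach of the constraints.  So u is dominated from
    below by a prefix of u0. *)
Lemma nonface_constraints a u0 u T : 0 < a -> u0 \in U -> T \subset facet a u0 ->
  T \in has_all_spaced n a (constraints (indices u)) -> u \in U.
Proof.
move=> a_gt0 u0U /subsetP sTF /meet_constraintsP dT.
set g := greedy_set a T; set s0 := indices u0; set s := indices u in dT *.
have s0_ind : index_seq m s0 := indices_index_seq u0.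
have s_ind : index_seq m s := indices_index_seq u.
have gg : gapped a g := greedy_gapped a 0 0 _.
have {}dT r : r < size s -> r < size g /\ nth 0 g r < nth 0 s r + a * r.
  by move=> /dT; rewrite has_spacedP // => /andP[-> lt_g]; split=> //; move: lt_g; rewrite -/g; nia.
(* B r: where the r-th block starts; the final segment counts as a block *)
pose B r := if r < size s0 then (nth 0 s0 r).-1 + a * r else m + a * size s0.
have B_le i j : i <= j -> j < size s0 -> B i <= B j.
  move=> le_ij lt_j; rewrite /B lt_j (leq_ltn_trans le_ij lt_j).
  have := sorted_leq_nth leq_trans leqnn 0 s0_ind.1 i j.
  by rewrite !inE => /(_ (leq_ltn_trans le_ij lt_j) lt_j le_ij); nia.
have B_tail i : B i <= m + a * size s0.
  rewrite /B; case: ifP => // lt_i.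
  have := leq_mul (leqnn a) (ltnW lt_i); have := index_seq_nth s0_ind lt_i; rewrite /=; lia.
have blockP x : x \in g -> m + a * size s0 <= x \/
    exists2 j, j < size s0 & B j <= x < B j + a.
  case/greedy_setP=> i /sTF; rewrite inE => /orP[/existsP[j bd_j]|tail] ->; last by left.
  by right; exists j => //; rewrite /B ltn_ord.
have B_min r : r <= size s0 -> r < size g -> B r <= nth 0 g r.
  elim: r => [|r IH] le_r lt_r.
    have := blockP (nth 0 g 0) (mem_nth 0 lt_r).
    case=> [tail|[j lt_j bd_j]]; first exact: leq_trans (B_tail _) tail.
    by apply: leq_trans (B_le 0 j (leq0n _) lt_j) _; case/andP: bd_j.
  have := blockP (nth 0 g r.+1) (mem_nth 0 lt_r).
  case=> [tail|[j lt_j bd_j]]; first exact: leq_trans (B_tail _) tail.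
  have lt_rj : r < j.
    rewrite ltnNge; apply/negP => le_jr.
    have := IH (ltnW le_r) (ltnW lt_r); have := B_le _ _ le_jr le_r.
    have := gapped_nth gg (leqnSn r) lt_r; rewrite subSnn muln1; lia.
  by apply: leq_trans (B_le _ _ lt_rj lt_j) _; case/andP: bd_j.
have le_size : size s <= size s0.
  rewrite leqNgt; apply/negP => lt_size; have [lt_g lt_nth] := dT _ lt_size.
  have := B_min _ (leqnn _) lt_g; rewrite /B ltnn.
  by have := index_seq_nth s_ind lt_size; lia.
have size_t : size (take (size s) s0) = size s by rewrite size_takel.
rewrite -(indicesK u) -/s; apply: (@order_ideal_shift (take (size s) s0)).
- by apply: index_seq_subseq (take_subseq _ _) _; apply: indices_index_seq.
- by [].
- by [].
- rewrite size_t => r lt_r; rewrite nth_take //; have [lt_g lt_nth] := dT r lt_r.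
  have lt_r0 := leq_trans lt_r le_size.
  have := B_min r (ltnW lt_r0) lt_g; rewrite /B lt_r0.
  by have := index_seq_nth s0_ind lt_r0; lia.
- exact: order_ideal_prefix.
Qed.

(* The index sequence read off from greedy positions *)
Definition greedy_indices a T k : seq nat :=
  [seq (nth 0 (greedy_set a T) r - a * r).+1 | r <- iota 0 k].

Lemma nth_greedy_indices a T k r : r < k ->
  nth 0 (greedy_indices a T k) r = (nth 0 (greedy_set a T) r - a * r).+1.
Proof. by move=> lt_r; rewrite (nth_map 0) ?size_iota // nth_iota. Qed.

Lemma greedy_indices_seq a T k : k <= size (greedy_set a T) ->
  (forall r, r < k -> nth 0 (greedy_indices a T k) r <= m) ->
  index_seq m (greedy_indices a T k).
Proof.
set s := greedy_indices a T k => le_k le_m.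
have size_s : size s = k by rewrite size_map size_iota.
split=> [|x /(nthP 0)[r]]; last first.
  rewrite size_s => lt_r <-; rewrite le_m // andbT.
  by rewrite nth_greedy_indices.
apply/(sortedP 0) => r; rewrite size_s => lt_r.
rewrite !nth_greedy_indices ?(ltnW lt_r) //.
have gg : gapped a (greedy_set a T) := greedy_gapped a 0 0 _.
have := gapped_nth gg (leqnSn r) (leq_trans lt_r le_k); rewrite subSnn muln1.
by rewrite ltnS mulnSr; lia.
Qed.

(** Let k be the number of greedy positions whose index is at most m.  The
    monomial formed by the first k indices (cut off at degree delta + 1)
    satisfies the constraints, so it is in U; hence it was not cut off, and T
    lies in its facet, since the other greedy positions are in the final
    segment. *)
Lemma face_constraints a T : 0 < a ->
  (forall cs, forbidden cs -> T \notin has_all_spaced n a cs) -> T \in facet_complex a.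
Proof.
move=> a_gt0 avoid; set g := greedy_set a T.
have gg : gapped a g := greedy_gapped a 0 0 _.
pose big r := m <= nth 0 g r - a * r.
pose k := find big (iota 0 (size g)).
have le_k : k <= size g by rewrite -[X in _ <= X](size_iota 0) find_size.
have small r : r < k -> nth 0 g r - a * r < m.
  move=> lt_rk; have := before_find 0 lt_rk; rewrite nth_iota ?(leq_trans lt_rk) //.
  by rewrite /big leqNgt => /negbFE.
have large r : k <= r -> r < size g -> m + a * k <= nth 0 g r.
  move=> le_kr lt_r; have lt_k := leq_ltn_trans le_kr lt_r.
  have : has big (iota 0 (size g)) by rewrite has_find -/k size_iota.
  move/(nth_find 0); rewrite -/k nth_iota // add0n /big.
  have := gapped_mono gg le_kr lt_r.
  have := greedy_nth_ge (a := a) (s := 0) (k := 0) (w := word T) lt_k.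
  by rewrite -/(greedy_set a T) -/g; lia.
pose k1 := minn k delta.+1; pose s := greedy_indices a T k1.
have size_s : size s = k1 by rewrite size_map size_iota.
have le_k1 : k1 <= k by apply: geq_minl.
have s_ind : index_seq m s.
  apply: greedy_indices_seq; first exact: leq_trans le_k1 le_k.
  by move=> r lt_r; rewrite nth_greedy_indices // small // (leq_trans lt_r).
have dT : T \in has_all_spaced n a (constraints s).
  apply/meet_constraintsP => r; rewrite size_s => lt_r.
  rewrite has_spacedP // nth_greedy_indices // -/g.
  by rewrite (leq_trans lt_r (leq_trans le_k1 le_k)) /=; nia.
have sU : monomial_of m s \in U.
  apply/negPn/negP => sU; suff /avoid : forbidden (constraints s) by rewrite dT.
  by exists (monomial_of m s); rewrite !monomial_ofK // size_s geq_minr.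
have eq_k : k1 = k.
  by have := U_degree sU; rewrite -size_indices monomial_ofK // size_s /k1; lia.
rewrite inE; apply/existsP; exists (facet a (monomial_of m s)); apply/andP; split.
  by apply/imsetP; exists [` sU]%fset.
apply/subsetP => x xT; rewrite inE !monomial_ofK //.
have [|y yg bd_y] := @greedy_cover a 0 0 (word T) x a_gt0 (leq0n _).
  by rewrite nth_word.
rewrite -/(greedy_set a T) -/g in yg; rewrite add0n in bd_y.
have {}bd_y : nth 0 g (index y g) <= x < nth 0 g (index y g) + a by rewrite nth_index.
have lt_r : index y g < size g by rewrite index_mem.
have [lt_rk|le_kr] := ltnP (index y g) k; last first.
  by rewrite size_s eq_k; apply/orP; right; have := large _ le_kr lt_r; lia.
apply/orP; left; apply/existsP.
have lt_rs : index y g < size s by rewrite size_s eq_k.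
exists (Ordinal lt_rs); rewrite nth_greedy_indices ?eq_k //= -/g.
have := greedy_nth_ge (a := a) (s := 0) (k := 0) (w := word T) lt_r.
by rewrite -/(greedy_set a T) -/g; lia.
Qed.

Lemma facet_complexP a T : 0 < a ->
  T \in ~: facet_complex a <-> exists2 cs, forbidden cs & T \in has_all_spaced n a cs.
Proof.
move=> a_gt0; rewrite inE; split=> [nT|[_ [u [uU _ ->]] dT]].
  case: (asboolP (exists2 cs, forbidden cs & T \in has_all_spaced n a cs)) => // noF.
  case/negP: nT; apply: face_constraints => // cs Fcs.
  by apply/negP => dT; apply: noF; exists cs.
apply/negP; rewrite inE => /existsP[F /andP[/imsetP[u0 _ ->] sTF]].
by rewrite (nonface_constraints a_gt0 (valP u0) sTF dT) in uU.
Qed.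

End OrderIdeal.

Lemma gen_complex_is_complex n (X : {set {set 'I_n}}) : is_complex (gen_complex X).
Proof.
move=> S T; rewrite !inE => /existsP[F /andP[FX sTF]] sST; apply/existsP.
by exists F; rewrite FX (subset_trans sST).
Qed.

(** Vertex x in 1..n is position x - 1, and d < n makes n - d = m + 1. *)
Lemma F_setE n d (u : 'X_{1..n - d - 1}) : d < n -> F_set n d u = facet n 2 u.
Proof.
move=> lt_dn; apply/setP => x; rewrite !inE; congr (_ || _); last by lia.
apply: eq_existsb => r; have := index_seq_nth (indices_index_seq u) (ltn_ord r); lia.
Qed.

Lemma L_setE n d (u : 'X_{1..n - d - 1}) : d < n -> L_set n d u = facet n 1 u.
Proof.
move=> lt_dn; apply/setP => x; rewrite !inE; congr (_ || _); last by lia.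
have s_nth := index_seq_nth (indices_index_seq u).
apply/mapP/existsP => [[r]|[r bd_r]].
  rewrite mem_iota /= => lt_r def_x; exists (Ordinal lt_r) => /=.
  have := s_nth _ lt_r; lia.
exists (val r); first by rewrite mem_iota ltn_ord.
by have := s_nth _ (ltn_ord r); rewrite /=; lia.
Qed.

(** * The exterior shifting of a squeezed ball *)

Section Shifting.
Variables (K : fieldType) (n m delta : nat) (U : {fset 'X_{1..m}}).
Hypothesis K_infinite : forall s : seq K, exists x : K, x \notin s.
Hypothesis U_shifted : shifted_order_ideal U.
Hypothesis U_degree : degree_at_most delta U.
Hypothesis le_mn : m + delta.*2 <= n.

Lemma forbidden_admissible cs : forbidden U delta cs -> all (admissible n) cs.
Proof.
case=> u [_ le_u ->]; apply/allP => _ /mapP[r + ->]; rewrite mem_iota /= => lt_r.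
have := index_seq_nth (indices_index_seq u) lt_r; rewrite /admissible /=; lia.
Qed.

Lemma ext_shifting_facets :
  ext_shifting K (facet_complex U n 2) = facet_complex U n 1.
Proof.
have [O [openO neO OA]] := generic_matrices n K_infinite.
apply: (ext_shifting_eq K_infinite _ _ openO neO); try exact: gen_complex_is_complex.
move=> A /OA[uA genA].
apply: (initials_join_has_spaced uA genA forbidden_admissible).
  by move=> S; apply: facet_complexP.
by move=> S; apply: facet_complexP.
Qed.

End Shifting.

(** * The Stanley-Reisner ideal *)

Section MonomialIdeals.
Local Open Scope ring_scope.
Variables (K : fieldType) (n : nat).
Local Notation R := {mpoly K[n]}.
Implicit Types (f g : R) (u v w : 'X_{1..n}).

Lemma ideal_gen_le (G H : R -> Prop) :
  (forall g, G g -> ideal_gen H g) -> forall f, ideal_gen G f -> ideal_gen H f.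
Proof.
move=> GH f [s [sG ->]]; elim: s sG => [|t s IH] sG.
  by exists [::]; split; rewrite ?big_nil.
have [s1 [s1H def1]] := IH (fun t' t's => sG t' (mem_behead (s := t :: s) t's)).
have [s2 [s2H def2]] := GH _ (sG t (mem_head _ _)).
exists ([seq (t.1.1 * x.1.1, x.1.2, x.2 * t.2) | x <- s2] ++ s1); split.
  by move=> x; rewrite mem_cat => /orP[/mapP[y /s2H Hy ->]|/s1H].
rewrite big_cons big_cat def1 def2; congr (_ + _).
rewrite big_map mulr_sumr mulr_suml; apply: eq_bigr => x _ /=.
by rewrite !mulrA.
Qed.

Lemma ideal_gen_mon (G : R -> Prop) u v : G 'X_[u] -> (u <= v)%MM -> ideal_gen G 'X_[v].
Proof.
move=> Gu le_uv; exists [:: (1, 'X_[u], 'X_[v - u])]; split.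
  by move=> t; rewrite inE => /eqP->.
by rewrite big_seq1 mul1r -mpolyXD addmC submK.
Qed.

Lemma monomial_in_ideal (P : 'X_{1..n} -> Prop) w :
  ideal_gen (fun g => exists2 u, P u & g = 'X_[u]) 'X_[w] <->
  exists2 u, P u & (u <= w)%MM.
Proof.
split=> [[s [sG def_w]]|[u Pu le_uw]]; last first.
  by apply: (@ideal_gen_mon _ u) le_uw; exists u.
have : (\sum_(t <- s) t.1.1 * t.1.2 * t.2)@_w != 0.
  by rewrite -def_w mcoeffX eqxx oner_eq0.
rewrite raddf_sum /= => nz.
have [t ts nzt] : exists2 t, t \in s & (t.1.1 * t.1.2 * t.2)@_w != 0.
  apply/hasP; apply: contraNT nz => /hasPn z; rewrite big1_seq // => t /andP[_ /z].
  by rewrite negbK => /eqP.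
have [u Pu def_u] := sG t ts; exists u => //.
move: nzt; rewrite def_u mulrAC -mcoeff_msupp.
case/msuppM_le/allpairsP=> -[v v'] /= [_ + ->]; rewrite msuppX inE => /eqP->.
exact: lem_addl.
Qed.

Definition set_monomial (S : {set 'I_n}) : 'X_{1..n} := [multinom (i \in S : nat) | i < n].

Lemma prod_set_monomial (S : {set 'I_n}) : \prod_(i in S) 'X_i = 'X_[set_monomial S] :> R.
Proof.
rewrite mpolyXE_id big_mkcond; apply: eq_bigr => i _.
by rewrite mnmE; case: (i \in S); rewrite ?expr1 ?expr0.
Qed.

End MonomialIdeals.

Section AlphaIdeal.
Variables (K : fieldType) (n m delta : nat) (U : {fset 'X_{1..m}}).
Hypothesis U_shifted : shifted_order_ideal U.
Hypothesis U_degree : degree_at_most delta U.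
Hypothesis le_mn : m + delta <= n.
Hypothesis le_m : m <= n.

Local Notation embed u := (monomial_of n (indices u)).
Local Notation I := (@I_of K n m U).
Local Notation Delta := (facet_complex U n 1).

Lemma indices_embed (u : 'X_{1..m}) : indices (embed u) = indices u.
Proof. exact/monomial_ofK/(index_seq_le le_m)/indices_index_seq. Qed.

Lemma mem_I_of (w : 'X_{1..n}) :
  I 'X_[w]%R <-> exists2 u : 'X_{1..m}, u \notin U & (embed u <= w)%MM.
Proof.
have -> : I 'X_[w]%R <-> ideal_gen (fun g : {mpoly K[n]} =>
    exists2 v, (exists2 u : 'X_{1..m}, u \notin U & v = embed u) & g = 'X_[v]%R) 'X_[w]%R.
  apply: ideal_gen_ext => g; split=> [[u uU ->]|[_ [u uU ->] ->]]; last by exists u.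
  by exists (embed u) => //; exists u.
rewrite monomial_in_ideal; split=> [[_ [u uU ->] le_w]|[u uU le_w]]; first by exists u.
by exists (embed u) => //; exists u.
Qed.

(** A generator of I(U) dividing the monomial of t is given by a subsequence
    of t.  A proper one is dominated from below by a strictly shorter prefix,
    which is in U, so it would be in U as well. *)
Lemma min_gens_prefix (s : seq nat) k : index_seq m s ->
  monomial_of m (take k s) \notin U ->
  (forall j, j < k -> monomial_of m (take j s) \in U) ->
  min_gens I (monomial_of n (take k s)).
Proof.
move=> s_ind kU minU; set t := take k s.
have t_ind : index_seq m t by apply: index_seq_subseq s_ind; apply: take_subseq.
have embed_t : embed (monomial_of m t) = monomial_of n t by rewrite monomial_ofK.
split; first by apply/mem_I_of; exists (monomial_of m t); rewrite ?embed_t ?lepm_refl.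
move=> v le_v /mem_I_of[u uU le_u].
have le_ut : (embed u <= monomial_of n t)%MM by apply: lepm_trans le_v.
have sub_ut : subseq (indices u) t.
  have /count_subseqP[s' sub_s' perm_s'] : forall x, count_mem x (indices u) <= count_mem x t.
    move=> x; have [bx|nbx] := boolP (0 < x <= n).
      case: x bx => // x lt_x; move/mnm_lepP: le_ut => /(_ (Ordinal lt_x)).
      by rewrite !count_monomial_of.
    rewrite (count_memPn _) //; apply: contra nbx => /indices_bound/andP[-> le_x].
    exact: leq_trans le_m.
  suff -> : indices u = s' by [].
  apply: (sorted_eq leq_trans anti_leq) perm_s'; first exact: indices_sorted.
  exact: (subseq_sorted leq_trans sub_s' t_ind.1).
have eq_ut : indices u = t.
  apply/eqP; rewrite -(size_subseq_leqif sub_ut) eqn_leq size_subseq // leqNgt.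
  apply/negP => lt_ut; case/negP: uU; rewrite -(indicesK u).
  have le_uk : size (indices u) < k.
    by apply: leq_trans lt_ut _; rewrite size_take; case: ltnP.
  have size_p : size (take (size (indices u)) s) = size (indices u).
    rewrite size_takel //; apply: leq_trans (ltnW lt_ut) _.
    by rewrite size_take; case: ltnP => // /ltnW.
  apply: (@order_ideal_shift _ _ U_shifted (take (size (indices u)) s)) (minU _ le_uk) => //.
  - by apply: index_seq_subseq s_ind; apply: take_subseq.
  - exact: indices_index_seq.
  - rewrite size_p => r lt_r; rewrite nth_take //.
    apply: subseq_nth_le s_ind.1 _ lt_r.
    exact: subseq_trans sub_ut (take_subseq _ _).
rewrite eq_ut in le_u.
by apply/mnmP => i; apply/eqP; rewrite eqn_leq (mnm_lepP le_v) (mnm_lepP le_u).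
Qed.

(** Minimal generators have degree at most delta + 1, as every monomial of that
    degree is already in I(U). *)
Lemma min_gensP (u : 'X_{1..n}) : min_gens I u ->
  exists u0 : 'X_{1..m}, [/\ u0 \notin U, u = embed u0 & size (indices u0) <= delta.+1].
Proof.
case=> /mem_I_of[u0 u0U le_u] minu.
have def_u : embed u0 = u by apply: minu => //; apply/mem_I_of; exists u0; rewrite ?lepm_refl.
exists u0; split=> //; rewrite leqNgt; apply/negP => lt_d.
set t := take delta.+1 (indices u0).
have size_t : size t = delta.+1 by rewrite size_takel // ltnW.
have t_ind : index_seq m t.
  by apply: index_seq_subseq (indices_index_seq u0); apply: take_subseq.
have tU : monomial_of m t \notin U.
  by apply/negP => /U_degree; rewrite -size_indices monomial_ofK // size_t ltnn.
have eq_t : monomial_of n t = embed u0.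
  rewrite def_u; apply: minu; first by rewrite -def_u monomial_of_le // take_subseq.
  by apply/mem_I_of; exists (monomial_of m t); rewrite ?monomial_ofK ?lepm_refl.
have := congr1 (size \o @indices n) eq_t.
rewrite /= indices_embed monomial_ofK; last exact: index_seq_le t_ind.
by rewrite size_t => eq_d; rewrite -eq_d ltnn in lt_d.
Qed.

Lemma size_alpha_seq s : size (alpha_seq s) = size s.
Proof. by rewrite size_map size_iota. Qed.

Lemma nth_alpha_seq s r : r < size s -> nth 0 (alpha_seq s) r = nth 0 s r + r.
Proof. by move=> lt_r; rewrite (nth_map 0) ?size_iota // nth_iota. Qed.

Lemma alpha_seq_sorted s : sorted leq s -> sorted ltn (alpha_seq s).
Proof.
move/(sortedP 0) => srt; apply/(sortedP 0) => r; rewrite size_alpha_seq => lt_r.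
by rewrite !nth_alpha_seq ?(ltnW lt_r) //= addnS ltnS leq_add2r srt.
Qed.

Definition alpha_set (s : seq nat) : {set 'I_n} := [set i : 'I_n | i.+1 \in alpha_seq s].

Lemma set_monomial_alpha s : sorted leq s ->
  set_monomial (alpha_set s) = monomial_of n (alpha_seq s).
Proof.
move=> srt; apply/mnmP => i; rewrite !mnmE inE count_uniq_mem //.
exact: (sorted_uniq ltn_trans ltnn) (alpha_seq_sorted srt).
Qed.

Lemma alpha_set_nonface (u : 'X_{1..m}) : u \notin U -> size (indices u) <= delta.+1 ->
  alpha_set (indices u) \notin Delta.
Proof.
move=> uU le_u; suff : alpha_set (indices u) \in ~: Delta by rewrite inE.
apply/(facet_complexP U_shifted U_degree) => //.
set s := indices u in le_u *; have s_ind : index_seq m s := indices_index_seq u.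
exists (constraints s); first by exists u.
apply/meet_constraintsP => r lt_r; pose t := map predn (alpha_seq s).
have size_t : size t = size s by rewrite size_map size_alpha_seq.
have nth_t j : j < size s -> nth 0 t j = (nth 0 s j + j).-1.
  by move=> lt_j; rewrite (nth_map 0) ?size_alpha_seq // nth_alpha_seq.
apply: (@has_spaced_gapped n 1 r _ _ t) => //; rewrite ?size_t //.
- apply/(sortedP 0) => j; rewrite size_t => lt_j; rewrite !nth_t ?(ltnW lt_j) //.
  have := index_seq_nth s_ind (ltnW lt_j); have := (sortedP 0 s_ind.1) j lt_j; lia.
- move=> x /(nthP 0)[j]; rewrite size_t => lt_j <-; have bd := index_seq_nth s_ind lt_j.
  have lt_n : nth 0 t j < n by rewrite nth_t //; lia.
  exists (Ordinal lt_n) => //; rewrite inE /=; apply/(nthP 0); exists j.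
    by rewrite size_alpha_seq.
  by rewrite nth_alpha_seq // nth_t //; lia.
- by rewrite nth_t //; have := index_seq_nth s_ind lt_r; lia.
Qed.

(** The greedy 1-spaced sequence is S itself, so the monomials [alpha] of the
    prefixes of its index sequence t are squarefree and supported in S. *)
Lemma nonface_alpha (S : {set 'I_n}) : S \notin Delta ->
  exists2 u, min_gens I u & (alpha u <= set_monomial S)%MM.
Proof.
rewrite -in_setC => /(facet_complexP U_shifted U_degree _ (isT : 0 < 1))[_ [u [uU le_u ->]]].
set s := indices u in le_u *; have s_ind : index_seq m s := indices_index_seq u.
move/meet_constraintsP=> dS; set g := greedy_set 1 S.
have {}dS r : r < size s -> r < size g /\ nth 0 g r < nth 0 s r + r.
  by move=> /dS; rewrite has_spacedP // mul0n addn0 => /andP[].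
have g_ge r : r < size g -> r <= nth 0 g r.
  by move=> lt_r; have := @greedy_nth_ge 1 0 0 (word S) r lt_r; rewrite mul1n.
pose t := greedy_indices 1 S (size s).
have size_t : size t = size s by rewrite size_map size_iota.
have le_sg : size s <= size g.
  by case: (size s) dS => // k /(_ k (ltnSn k))[].
have nth_t r : r < size s -> nth 0 t r = (nth 0 g r - r).+1.
  by move=> lt_r; rewrite nth_greedy_indices // mul1n.
have le_ts r : r < size t -> nth 0 t r <= nth 0 s r.
  rewrite size_t => lt_r; rewrite nth_t //; have [/g_ge] := dS r lt_r; lia.
have t_ind : index_seq m t.
  apply: greedy_indices_seq => // r lt_r; have := index_seq_nth s_ind lt_r.
  by have := le_ts r; rewrite size_t => /(_ lt_r); rewrite -/t; lia.
have tU : monomial_of m t \notin U.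
  apply: contra uU => tU; rewrite -(indicesK u).
  exact: (order_ideal_shift U_shifted t_ind s_ind size_t le_ts).
have ex_k : exists k, monomial_of m (take k t) \notin U.
  by exists (size t); rewrite take_size.
case: (ex_minnP ex_k) => k kU min_k; set v := take k t.
have v_ind : index_seq m v by apply: index_seq_subseq t_ind; apply: take_subseq.
exists (monomial_of n v).
  apply: min_gens_prefix => // j lt_j; apply/negPn/negP => /min_k.
  by rewrite leqNgt lt_j.
rewrite /alpha monomial_ofK; last exact: index_seq_le v_ind.
apply/mnm_lepP => i; rewrite !mnmE count_uniq_mem; last first.
  exact: (sorted_uniq ltn_trans ltnn) (alpha_seq_sorted v_ind.1).
case: (boolP (i.+1 \in _)) => //= /(nthP 0)[r]; rewrite size_alpha_seq => lt_r.
have lt_rk : r < k.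
  by move: lt_r; rewrite size_take; case: (ltnP k (size t)) => // le_tk /leq_trans; apply.
have lt_rs : r < size s.
  by rewrite -size_t; apply: leq_trans lt_r _; rewrite size_take; case: ltnP => // /ltnW.
rewrite nth_alpha_seq // nth_take // nth_t // => def_i.
have [lt_g _] := dS r lt_rs; have := g_ge r lt_g => le_rg.
have /greedy_setP[j jS eq_j] : nth 0 g r \in greedy_set 1 S by rewrite mem_nth.
suff -> : i = j by rewrite jS.
by apply: val_inj => /=; lia.
Qed.

Lemma SR_ideal_alpha (f : {mpoly K[n]}) : SR_ideal Delta f <-> alpha_ideal I f.
Proof.
split; apply: ideal_gen_le => g [].
  move=> S /nonface_alpha[u minu le_u] ->; rewrite prod_set_monomial.
  by apply: ideal_gen_mon le_u; exists u.
move=> u /min_gensP[u0 [u0U -> le_u0]] ->.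
rewrite /alpha indices_embed -set_monomial_alpha ?indices_sorted //.
apply: (@ideal_gen_mon _ _ _ (set_monomial (alpha_set (indices u0)))); last exact: lepm_refl.
by exists (alpha_set (indices u0)); [apply: alpha_set_nonface|rewrite prod_set_monomial].
Qed.

End AlphaIdeal.

Theorem corollary7p7 (K : fieldType)
    (K_infinite : forall s : seq K, exists x : K, x \notin s)
    (n d : nat) (d_gt0 : 0 < d) (d_lt_n : d < n)
    (U : {fset 'X_{1..(n - d - 1)}})
    (U_shifted : shifted_order_ideal U)
    (U_degree : degree_at_most ((d + 1) %/ 2) U) :
  (forall f : {mpoly K[n]},
     SR_ideal (ext_shifting K (squeezed_ball n d U)) f
     <-> alpha_ideal (I_of (K := K) (n := n) U) f)
  /\ ext_shifting K (squeezed_ball n d U)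
     = gen_complex [set L_set n d (fsval u) | u : U].
Proof.
have ballE : squeezed_ball n d U = facet_complex U n 2.
  by congr gen_complex; apply: eq_imset => u; apply: F_setE.
have LE : gen_complex [set L_set n d (fsval u) | u : U] = facet_complex U n 1.
  by congr gen_complex; apply: eq_imset => u; apply: L_setE.
have shiftE := @ext_shifting_facets K n _ _ U K_infinite U_shifted U_degree.
rewrite ballE LE shiftE; last by lia.
by split=> // f; apply: SR_ideal_alpha U_shifted U_degree _ _ f; lia.
Qed.
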